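(* Consider minimizing $f(x)$ subject to $g(x)\in\Theta$, where $\Theta\subset\mathbb{R}^m$ is a convex polyhedron, $f:\mathbb{R}^n\to\mathbb{R}$ and $g:\mathbb{R}^n\to\mathbb{R}^m$ are $\mathcal C^2$-smooth around a feasible $\bar x$, MSCQ holds at $\bar x$, and there is $\bar y\in N_\Theta(g(\bar x))$ with $\nabla f(\bar x)+\nabla g(\bar x)^*\bar y=0$. Let $\varphi:=f+\delta_\Gamma$. (i) If there are neighborhoods $U$ of $\bar x$ and $V$ of $0$ such that $\langle\nabla^2f(x)w,w\rangle+\langle w,\nabla^2\langle y,g\rangle(x)w\rangle\ge0$ for all $x\in U$, $v\in V$, $w\in-K_\Gamma(x,v-\nabla f(x))$ and $y\in\Lambda(x,v)$, then $\varphi$ is variationally convex at $\bar x$ for $0$; consequently $\bar x$ is a local minimizer of the problem. (ii) If there are $\sigma>0$ and neighborhoods $U$ of $\bar x$ and $V$ of $0$ such that $\langle\nabla^2f(x)w,w\rangle+\langle w,\nabla^2\langle y,g\rangle(x)w\rangle\ge\sigma\|w\|^2$ for all $x\in U$, $v\in V$, $w\in-K_\Gamma(x,v-\nabla f(x))$ and $y\in\Lambda(x,v)$, then $\varphi$ is strongly variationally convex at $\bar x$ for $0$ with modulus $\sigma$; consequently $\bar x$ is a tilt-stable local minimizer of $\varphi$ with modulus $\sigma^{-1}$, in particular a strong local minimizer of the problem.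
   Context: $\Gamma:=\{x:g(x)\in\Theta\}$, $\delta_\Gamma$ its indicator function; $\Lambda(x,v):=\{y:v=\nabla f(x)+\nabla g(x)^*y,\ y\in N_\Theta(g(x))\}$. MSCQ at $\bar x$: $\operatorname{dist}(x;\Gamma)\le\kappa\operatorname{dist}(g(x);\Theta)$ for some $\kappa>0$ and all $x$ near $\bar x$. Tangent cone $T_\Gamma(x):=\{w:\exists t_k\downarrow0,w_k\to w,x+t_kw_k\in\Gamma\}$; critical cone $K_\Gamma(x,u):=T_\Gamma(x)\cap\{u\}^\perp$. Variational convexity of l.s.c. $\varphi$ at $\bar x$ for $\bar v\in\partial\varphi(\bar x)$ ($\partial$ the limiting subdifferential): there exist a convex neighborhood $U\times V$ of $(\bar x,\bar v)$, $\varepsilon>0$ and an l.s.c. convex $\psi\le\varphi$ on $U$ with $(U_\varepsilon\times V)\cap\operatorname{gph}\partial\varphi=(U\times V)\cap\operatorname{gph}\partial\psi$ and $\varphi=\psi$ at common elements, where $U_\varepsilon:=\{x\in U:\varphi(x)<\varphi(\bar x)+\varepsilon\}$; strong variational convexity with modulus $\sigma$: the same with $\psi$ strongly convex on $U$ with modulus $\sigma$. Tilt-stable local minimizer: there is $\gamma>0$ such that $M_\gamma(v):=\operatorname{argmin}\{\varphi(x)-\langle v,x\rangle:\|x-\bar x\|\le\gamma\}$ is single-valued and Lipschitz continuous on a neighborhood of $0$ with $M_\gamma(0)=\{\bar x\}$; its modulus is a Lipschitz constant of $M_\gamma$ there. *)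

(* Defs.v *)
From HB Require Import structures.
From mathcomp Require Import all_boot all_order all_algebra.
From mathcomp Require Import all_classical all_reals all_analysis.
Set Implicit Arguments. Unset Strict Implicit. Unset Printing Implicit Defensive.
Import Order.TTheory GRing.Theory Num.Theory.
Import numFieldNormedType.Exports.
Local Open Scope classical_set_scope.
Local Open Scope ring_scope.

Section Defs.
Variable R : realType.

Definition dot (n : nat) (u v : 'rV[R]_n) : R := \sum_(i < n) u 0 i * v 0 i.
Definition enorm (n : nat) (u : 'rV[R]_n) : R := Num.sqrt (dot u u).
Definition edist (n : nat) (u v : 'rV[R]_n) : R := enorm (u - v).
Definition setdist (n : nat) (x : 'rV[R]_n) (S : set 'rV[R]_n) : R :=
  inf [set edist x y | y in S].

Definition is_nbhd (n : nat) (U : set 'rV[R]_n) (x : 'rV[R]_n) : Prop :=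
  exists r : R, 0 < r /\ forall u, edist u x < r -> U u.
Definition is_open (n : nat) (U : set 'rV[R]_n) : Prop :=
  forall x, U x -> is_nbhd U x.
Definition is_convex_set (n : nat) (U : set 'rV[R]_n) : Prop :=
  forall x y (t : R), U x -> U y -> 0 <= t <= 1 -> U (t *: x + (1 - t) *: y).

Definition seq_cvg (n : nat) (u : nat -> 'rV[R]_n) (x : 'rV[R]_n) : Prop :=
  forall e : R, 0 < e -> exists N : nat, forall k, (N <= k)%N -> edist (u k) x < e.

Definition convex_polyhedron (m : nat) (Theta : set 'rV[R]_m) : Prop :=
  exists (k : nat) (A : 'M[R]_(k, m)) (b : 'rV[R]_k),
    Theta = [set z | forall i : 'I_k, dot (row i A) z <= b 0 i].

Definition normal_cone (m : nat) (Theta : set 'rV[R]_m) (z : 'rV[R]_m) : set 'rV[R]_m :=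
  [set y | Theta z /\ forall z', Theta z' -> dot y (z' - z) <= 0].

Definition tangent_cone (n : nat) (G : set 'rV[R]_n) (x : 'rV[R]_n) : set 'rV[R]_n :=
  [set w | exists (t : nat -> R) (ws : nat -> 'rV[R]_n),
     (forall k, 0 < t k) /\
     (forall e : R, 0 < e -> exists N : nat, forall k, (N <= k)%N -> t k < e) /\
     seq_cvg ws w /\ (forall k, G (x + t k *: ws k))].
Definition critical_cone (n : nat) (G : set 'rV[R]_n) (x u : 'rV[R]_n) : set 'rV[R]_n :=
  [set w | tangent_cone G x w /\ dot u w = 0].

Definition e_ (n : nat) (i : 'I_n) : 'rV[R]_n := delta_mx 0 i.
Definition grad (n : nat) (f : 'rV[R]_n -> R) (x : 'rV[R]_n) : 'rV[R]_n :=
  \row_i ('d f x (e_ i)).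
Definition hessq (n : nat) (f : 'rV[R]_n -> R) (x w : 'rV[R]_n) : R :=
  dot ('d (grad f) x w) w.
Definition C2_around (n : nat) (f : 'rV[R]_n -> R) (xbar : 'rV[R]_n) : Prop :=
  exists O : set 'rV[R]_n, is_open O /\ O xbar /\
    forall x, O x ->
      differentiable f x /\ differentiable (grad f) x /\
      forall i j : 'I_n,
        {for x, continuous (fun u => 'd (grad f) u (e_ j) 0 i)}.

Definition comp_fun (n m : nat) (g : 'rV[R]_n -> 'rV[R]_m) (j : 'I_m) : 'rV[R]_n -> R :=
  fun x => g x 0 j.
Definition jac_adj (n m : nat) (g : 'rV[R]_n -> 'rV[R]_m) (x : 'rV[R]_n) (y : 'rV[R]_m)
  : 'rV[R]_n := \sum_(j < m) y 0 j *: grad (comp_fun g j) x.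
Definition hessq_yg (n m : nat) (g : 'rV[R]_n -> 'rV[R]_m) (y : 'rV[R]_m) (x w : 'rV[R]_n)
  : R := \sum_(j < m) y 0 j * hessq (comp_fun g j) x w.

Definition feas (n m : nat) (g : 'rV[R]_n -> 'rV[R]_m) (Theta : set 'rV[R]_m) : set 'rV[R]_n :=
  [set x | Theta (g x)].
Definition phi_fun (n m : nat) (f : 'rV[R]_n -> R) (g : 'rV[R]_n -> 'rV[R]_m)
  (Theta : set 'rV[R]_m) (x : 'rV[R]_n) : \bar R :=
  if `[< Theta (g x) >] then (f x)%:E else +oo%E.

Definition Lambda (n m : nat) (f : 'rV[R]_n -> R) (g : 'rV[R]_n -> 'rV[R]_m)
  (Theta : set 'rV[R]_m) (x v : 'rV[R]_n) : set 'rV[R]_m :=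
  [set y | v = grad f x + jac_adj g x y /\ normal_cone Theta (g x) y].

Definition MSCQ (n m : nat) (g : 'rV[R]_n -> 'rV[R]_m) (Theta : set 'rV[R]_m)
  (xbar : 'rV[R]_n) : Prop :=
  exists kappa : R, 0 < kappa /\
    exists U, is_nbhd U xbar /\
      forall x, U x -> setdist x (feas g Theta) <= kappa * setdist (g x) Theta.

Definition reg_subdiff (n : nat) (phi : 'rV[R]_n -> \bar R) (x : 'rV[R]_n) : set 'rV[R]_n :=
  [set v | phi x \is a fin_num /\
     forall e : R, 0 < e -> exists d : R, 0 < d /\ forall u, edist u x < d ->
       ((fine (phi x) + dot v (u - x) - e * edist u x)%:E <= phi u)%E].
Definition lim_subdiff (n : nat) (phi : 'rV[R]_n -> \bar R) (x : 'rV[R]_n) : set 'rV[R]_n :=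
  [set v | phi x \is a fin_num /\
     exists (xs vs : nat -> 'rV[R]_n),
       seq_cvg xs x /\ seq_cvg vs v /\
       (forall k, reg_subdiff phi (xs k) (vs k)) /\
       (forall e : R, 0 < e -> exists N : nat, forall k, (N <= k)%N ->
          `| fine (phi (xs k)) - fine (phi x) | < e)].

(* lower semicontinuity on U, convexity / strong convexity on U (epigraphical form) *)
Definition lsc_on (n : nat) (U : set 'rV[R]_n) (psi : 'rV[R]_n -> \bar R) : Prop :=
  forall x, U x -> forall a : R, (a%:E < psi x)%E ->
    exists d : R, 0 < d /\ forall u, U u -> edist u x < d -> (a%:E < psi u)%E.
Definition convex_fun_on (n : nat) (U : set 'rV[R]_n) (psi : 'rV[R]_n -> \bar R) : Prop :=
  forall x y (t a b : R), U x -> U y -> 0 <= t <= 1 ->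
    (psi x <= a%:E)%E -> (psi y <= b%:E)%E ->
    (psi (t *: x + (1 - t) *: y)%R <= (t * a + (1 - t) * b)%:E)%E.
Definition strongly_convex_fun_on (n : nat) (U : set 'rV[R]_n) (psi : 'rV[R]_n -> \bar R)
  (sigma : R) : Prop :=
  forall x y (t a b : R), U x -> U y -> 0 <= t <= 1 ->
    (psi x <= a%:E)%E -> (psi y <= b%:E)%E ->
    (psi (t *: x + (1 - t) *: y)%R <=
       (t * a + (1 - t) * b - sigma / 2 * t * (1 - t) * edist x y ^+ 2)%:E)%E.

Definition vc_local (n : nat) (phi psi : 'rV[R]_n -> \bar R) (xbar : 'rV[R]_n)
  (U V : set 'rV[R]_n) (eps : R) : Prop :=
  (forall x, U x -> (psi x <= phi x)%E) /\
  (forall x v,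
     (U x /\ (phi x < phi xbar + eps%:E)%E /\ V v /\ lim_subdiff phi x v) <->
     (U x /\ V v /\ lim_subdiff psi x v)) /\
  (forall x v, U x /\ (phi x < phi xbar + eps%:E)%E /\ V v /\ lim_subdiff phi x v ->
     phi x = psi x).

Definition var_convex (n : nat) (phi : 'rV[R]_n -> \bar R) (xbar vbar : 'rV[R]_n) : Prop :=
  lim_subdiff phi xbar vbar /\
  exists (U V : set 'rV[R]_n) (eps : R),
    is_open U /\ is_convex_set U /\ U xbar /\
    is_open V /\ is_convex_set V /\ V vbar /\ 0 < eps /\
    exists psi : 'rV[R]_n -> \bar R,
      lsc_on U psi /\ convex_fun_on U psi /\ vc_local phi psi xbar U V eps.

Definition strongly_var_convex (n : nat) (phi : 'rV[R]_n -> \bar R) (xbar vbar : 'rV[R]_n)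
  (sigma : R) : Prop :=
  lim_subdiff phi xbar vbar /\
  exists (U V : set 'rV[R]_n) (eps : R),
    is_open U /\ is_convex_set U /\ U xbar /\
    is_open V /\ is_convex_set V /\ V vbar /\ 0 < eps /\
    exists psi : 'rV[R]_n -> \bar R,
      lsc_on U psi /\ strongly_convex_fun_on U psi sigma /\ vc_local phi psi xbar U V eps.

Definition M_tilt (n : nat) (phi : 'rV[R]_n -> \bar R) (xbar : 'rV[R]_n) (gamma : R)
  (v : 'rV[R]_n) : set 'rV[R]_n :=
  [set x | edist x xbar <= gamma /\
     forall u, edist u xbar <= gamma -> (phi x - (dot v x)%:E <= phi u - (dot v u)%:E)%E].

Definition tilt_stable (n : nat) (phi : 'rV[R]_n -> \bar R) (xbar : 'rV[R]_n) (kappa : R)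
  : Prop :=
  exists gamma : R, 0 < gamma /\
  exists (W : set 'rV[R]_n) (M : 'rV[R]_n -> 'rV[R]_n),
    is_nbhd W 0 /\
    (forall v, W v -> M_tilt phi xbar gamma v = [set M v]) /\
    M 0 = xbar /\
    (forall v1 v2, W v1 -> W v2 -> edist (M v1) (M v2) <= kappa * edist v1 v2).

Definition local_min (n : nat) (f : 'rV[R]_n -> R) (G : set 'rV[R]_n) (xbar : 'rV[R]_n) : Prop :=
  G xbar /\ exists U, is_nbhd U xbar /\ forall x, U x -> G x -> f xbar <= f x.
Definition strong_local_min (n : nat) (f : 'rV[R]_n -> R) (G : set 'rV[R]_n)
  (xbar : 'rV[R]_n) : Prop :=
  G xbar /\ exists kappa : R, 0 < kappa /\ exists U, is_nbhd U xbar /\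
    forall x, U x -> G x -> f xbar + kappa * edist x xbar ^+ 2 <= f x.

End Defs.

(* Main.v *)
(* The second-order condition is turned into the uniform quadratic growth
     f x' >= f x + <v, x' - x> + (sigma / 2) |x' - x|^2
   for all feasible x' near xbar and all (x, v) near (xbar, 0) with v a regular subgradient
   of phi at x.  Metric subregularity gives such v multipliers y with a uniform bound, so
   phi is prox-regular and its proximal map P is well defined and Lipschitz near xbar.
   Differentiating P along a segment, the limits of difference quotients are critical
   directions to which the second-order condition applies, which makes P firmly
   nonexpansive with a gain depending on sigma; hence the Moreau envelope is (strongly)
   convex and the growth follows.  The convex function required by variational convexity is
   the supremum of the quadratic minorants of the growth inequality, and the equality of
   the graphs is Minty's argument.  The growth inequality also gives the minimality and
   tilt-stability statements.  Polyhedrality of Theta is used only through closedness and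
   convexity. *)

From HB Require Import structures.
From mathcomp Require Import all_boot all_order all_algebra.
From mathcomp Require Import all_classical all_reals all_analysis.
From mathcomp Require Import lra ring.
Require Import Defs.
Set Implicit Arguments. Unset Strict Implicit. Unset Printing Implicit Defensive.
Import Order.TTheory GRing.Theory Num.Theory.
Import numFieldNormedType.Exports.
Local Open Scope classical_set_scope.
Local Open Scope ring_scope.

(** * Euclidean spaces and sequences *)

(** The condition is infinitesimal and bears on the graph of a set-valued map, while [feas g Theta]
    need not be convex, so it cannot be integrated between two feasible points. The substitution z =
    x + v / (2 rho) resolves this: near (xbar, 0) the graph of regular subgradients becomes the set
    of pairs (P z, 2 rho (z - P z)) with z in a ball, where segments are available. P is Lipschitz
    but possibly not differentiable, hence the integration by one-sided difference quotients in
    [dini_nondecreasing]. The uniform bound on multipliers serves twice: to get one [rho] for all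
    nearby subgradients, and to extract a limit multiplier along the difference quotients. Parts (i)
    and (ii) share one argument with sigma >= 0. It deals with regular subgradients; limiting ones
    are reached at the end, by passing to the limit in the growth inequality. *)

Section Euclid.
Variable R : realType.
Variable n : nat.
Implicit Types (u v w : 'rV[R]_n) (a : R).

Lemma dotC u v : dot u v = dot v u.
Proof. by apply: eq_bigr => i _; rewrite mulrC. Qed.
Lemma dotDl u v w : dot (u + v) w = dot u w + dot v w.
Proof. by rewrite /dot -big_split; apply: eq_bigr => i _; rewrite mxE mulrDl. Qed.
Lemma dotZl a u v : dot (a *: u) v = a * dot u v.
Proof. by rewrite /dot mulr_sumr; apply: eq_bigr => i _; rewrite mxE mulrA. Qed.
Lemma dotDr u v w : dot u (v + w) = dot u v + dot u w.
Proof. by rewrite dotC dotDl !(dotC u). Qed.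
Lemma dotZr a u v : dot u (a *: v) = a * dot u v.
Proof. by rewrite dotC dotZl dotC. Qed.
Lemma dotNl u v : dot (- u) v = - dot u v.
Proof. by rewrite -scaleN1r dotZl mulN1r. Qed.
Lemma dotNr u v : dot u (- v) = - dot u v.
Proof. by rewrite dotC dotNl dotC. Qed.
Lemma dotBl u v w : dot (u - v) w = dot u w - dot v w.
Proof. by rewrite dotDl dotNl. Qed.
Lemma dotBr u v w : dot u (v - w) = dot u v - dot u w.
Proof. by rewrite dotDr dotNr. Qed.
Lemma dot0l u : dot 0 u = 0.
Proof. by rewrite -(scale0r 0) dotZl mul0r. Qed.
Lemma dot0r u : dot u 0 = 0.
Proof. by rewrite dotC dot0l. Qed.
Lemma dot_suml (I : finType) (F : I -> 'rV[R]_n) u :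
  dot (\sum_i F i) u = \sum_i dot (F i) u.
Proof. by apply: (big_morph (fun x => dot x u)) => [x y|]; [exact: dotDl|exact: dot0l]. Qed.
Lemma dot_ge0 u : 0 <= dot u u.
Proof. by apply: sumr_ge0 => i _; rewrite -expr2 sqr_ge0. Qed.
Lemma enorm_ge0 u : 0 <= enorm u.
Proof. exact: sqrtr_ge0. Qed.
Lemma sqr_enorm u : enorm u ^+ 2 = dot u u.
Proof. by rewrite sqr_sqrtr// dot_ge0. Qed.
Lemma coordB u v i : (u - v) 0 i = u 0 i - v 0 i.
Proof. by rewrite !mxE. Qed.
Lemma coord_le_enorm u i : `|u 0 i| <= enorm u.
Proof.
rewrite -sqrtr_sqr ler_sqrt ?dot_ge0// /dot (bigD1 i)//= -expr2 lerDl.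
by apply: sumr_ge0 => j _; rewrite -expr2 sqr_ge0.
Qed.
Lemma enorm0 : enorm (0 : 'rV[R]_n) = 0.
Proof. by rewrite /enorm dot0l sqrtr0. Qed.
Lemma enorm0_eq0 u : enorm u = 0 -> u = 0.
Proof.
move=> u0; apply/rowP => i; rewrite mxE; apply/eqP.
by rewrite -normr_le0 -u0 coord_le_enorm.
Qed.
Lemma enormZ a u : enorm (a *: u) = `|a| * enorm u.
Proof. by rewrite /enorm dotZl dotZr mulrA -expr2 sqrtrM ?sqr_ge0// sqrtr_sqr. Qed.
Lemma enormN u : enorm (- u) = enorm u.
Proof. by rewrite -scaleN1r enormZ normrN1 mul1r. Qed.
Lemma enormBC u v : enorm (u - v) = enorm (v - u).
Proof. by rewrite -enormN opprB. Qed.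
Lemma cauchy_schwarz u v : dot u v <= enorm u * enorm v.
Proof.
have [/eqP/enorm0_eq0 ->|u0] := boolP (enorm u == 0).
  by rewrite dot0l enorm0 mul0r.
have [/eqP/enorm0_eq0 ->|v0] := boolP (enorm v == 0).
  by rewrite dot0r enorm0 mulr0.
have up : 0 < enorm u by rewrite lt_def u0 enorm_ge0.
have vp : 0 < enorm v by rewrite lt_def v0 enorm_ge0.
have := dot_ge0 (enorm v *: u - enorm u *: v).
rewrite dotBl !dotBr !dotZl !dotZr -!sqr_enorm (dotC v u) => h.
have {}h : 0 <= enorm u * enorm v * (enorm u * enorm v - dot u v) by nra.
by rewrite pmulr_rge0 ?mulr_gt0// subr_ge0 in h.
Qed.
Lemma cauchy_schwarzN u v : - (enorm u * enorm v) <= dot u v.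
Proof. by rewrite lerNl -dotNl (le_trans (cauchy_schwarz _ _))// enormN. Qed.
Lemma cauchy_schwarz_abs u v : `|dot u v| <= enorm u * enorm v.
Proof. by rewrite ler_norml cauchy_schwarz cauchy_schwarzN. Qed.
Lemma enormD u v : enorm (u + v) <= enorm u + enorm v.
Proof.
rewrite -(@ler_pXn2r _ 2)// ?nnegrE ?addr_ge0 ?enorm_ge0// sqr_enorm.
rewrite dotDl !dotDr -!sqr_enorm (dotC v u); have := cauchy_schwarz u v; nra.
Qed.
Lemma sqr_enormD u v :
  enorm (u + v) ^+ 2 = enorm u ^+ 2 + 2 * dot u v + enorm v ^+ 2.
Proof. by rewrite !sqr_enorm dotDl !dotDr (dotC v u); ring. Qed.
Lemma sqr_enormB u v :
  enorm (u - v) ^+ 2 = enorm u ^+ 2 - 2 * dot u v + enorm v ^+ 2.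
Proof. by rewrite sqr_enormD dotNr enormN; ring. Qed.
Lemma edistC u v : edist u v = edist v u.
Proof. exact: enormBC. Qed.
Lemma edistxx u : edist u u = 0.
Proof. by rewrite /edist subrr enorm0. Qed.
Lemma edist_ge0 u v : 0 <= edist u v.
Proof. exact: enorm_ge0. Qed.
Lemma edist_triangle w u v : edist u v <= edist u w + edist w v.
Proof. by rewrite /edist -(subrKA w u) enormD. Qed.
Lemma enorm_le_sum u : enorm u <= \sum_i `|u 0 i|.
Proof.
have s0 : 0 <= \sum_i `|u 0 i| by apply: sumr_ge0.
rewrite -[leRHS]ger0_norm// -[leRHS]sqrtr_sqr ler_sqrt ?sqr_ge0//.
rewrite expr2 mulr_suml; apply: ler_sum => i _.
rewrite (le_trans (ler_norm _))// normrM ler_wpM2l//.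
by rewrite (bigD1 i)//= lerDl sumr_ge0.
Qed.
Lemma mx_norm_le_enorm u : `|u| <= enorm u.
Proof.
rewrite [leLHS]mx_normrE; apply/bigmax_leP; split; first exact: enorm_ge0.
by move=> -[i j] _ /=; rewrite (ord1 i) coord_le_enorm.
Qed.
Lemma enorm_le_mx_norm u : enorm u <= n%:R * `|u|.
Proof.
rewrite (le_trans (enorm_le_sum _))//.
apply: (@le_trans _ _ (\sum_(i < n) `|u|)).
  apply: ler_sum => i _; rewrite [leRHS]mx_normrE.
  by apply: (@le_bigmax _ _ _ _ (fun ij => `|u ij.1 ij.2|) (0, i)).
by rewrite sumr_const card_ord mulr_natl.
Qed.
Lemma row_sum_e u : u = \sum_i u 0 i *: e_ R i.
Proof. exact: row_sum_delta. Qed.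

Lemma dist_convex u v w (t r : R) : 0 <= t <= 1 -> edist u w < r -> edist v w < r ->
  edist (t *: u + (1 - t) *: v) w < r.
Proof.
move=> /andP[t0 t1] uw vw; rewrite /edist.
have -> : t *: u + (1 - t) *: v - w = t *: (u - w) + (1 - t) *: (v - w).
  by apply/rowP => i; rewrite !mxE; ring.
apply: le_lt_trans (enormD _ _) _; rewrite !enormZ ger0_norm// ger0_norm ?subr_ge0//.
rewrite /edist in uw vw.
have [->|tn] := eqVneq t 0; first by rewrite mul0r add0r subr0 mul1r.
have tp : 0 < t by rewrite lt_def tn.
have h : t * enorm (u - w) < t * r by rewrite ltr_pM2l.
have h2 : (1 - t) * enorm (v - w) <= (1 - t) * r.
  by rewrite ler_wpM2l ?subr_ge0// ltW.
lra.
Qed.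

Lemma is_open_ball (x : 'rV[R]_n) (r : R) : is_open [set u | edist u x < r].
Proof.
move=> u /= ux; exists (r - edist u x); split; first by rewrite subr_gt0.
by move=> w wu; apply: le_lt_trans (edist_triangle u _ _) _; rewrite -ltrBrDr.
Qed.
Lemma is_convex_ball (x : 'rV[R]_n) (r : R) : is_convex_set [set u | edist u x < r].
Proof. by move=> u v t /= ur vr t01; exact: dist_convex. Qed.

End Euclid.

(** The topology on row vectors comes from the max norm, while the definitions use the Euclidean
    norm. The two norms are equivalent up to the factor [n], replaced by n + 1 to cover n = 0. *)
Lemma nbhs_edist (R : realType) n (A : set 'rV[R]_n) x :
  nbhs x A <-> is_nbhd A x.
Proof.
split.
  move=> /nbhs_ballP [e /= e0 eA].
  exists e; split => // u ux; apply: eA; rewrite -ball_normE /=.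
  by apply: le_lt_trans ux; rewrite -normrN opprB mx_norm_le_enorm.
move=> [r [r0 rA]]; apply/nbhs_ballP.
have n0 : 0 < n%:R + 1 :> R by rewrite ltr_wpDl.
exists (r / (n%:R + 1)) => /=; first by rewrite divr_gt0.
move=> u; rewrite -ball_normE /= => xu; apply: rA.
rewrite /edist enormBC (le_lt_trans (enorm_le_mx_norm _))//.
move: xu; rewrite ltr_pdivlMr// => xu; apply: le_lt_trans xu.
by rewrite mulrC ler_wpM2l// lerDl.
Qed.

Section Sequences.
Variable R : realType.

Lemma cvg_sum_real (I : finType) (a : I -> nat -> R) (b : I -> R) :
  (forall i, a i @ \oo --> b i) ->
  (fun k => \sum_i a i k) @ \oo --> \sum_i b i.
Proof. by move=> ab; apply: cvg_big => // ; exact: add_continuous. Qed.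

Lemma seq_cvg_coord n (u : nat -> 'rV[R]_n) x :
  seq_cvg u x <-> forall i, (fun k => u k 0 i) @ \oo --> x 0 i.
Proof.
split.
  move=> ux i; apply/cvgrPdist_lt => e e0; have [N HN] := ux _ e0.
  exists N => // k /= Nk; rewrite distrC; apply: le_lt_trans (HN k Nk).
  by apply: le_trans (coord_le_enorm _ i); rewrite !mxE.
move=> ux e e0.
have : (fun k => \sum_i `|u k 0 i - x 0 i|) @ \oo --> (\sum_(i < n) (0:R)).
  have c i : (fun k => `|u k 0 i - x 0 i|) @ \oo --> (0:R).
    rewrite -[X in _ --> X](@normr0 R R) -(subrr (x 0 i)); apply: cvg_norm.
    by apply: cvgB => //; exact: cvg_cst.
  by apply: cvg_sum_real.
rewrite big1// => /cvgrPdist_lt /(_ e e0)[N _ HN].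
exists N => k Nk; have := HN k Nk; rewrite /= sub0r normrN ger0_norm; last first.
  by apply: sumr_ge0.
apply: le_lt_trans; apply: le_trans (enorm_le_sum _) _.
by apply: ler_sum => i _; rewrite !mxE.
Qed.

Lemma seq_cvg_cst n (x : 'rV[R]_n) : seq_cvg (fun=> x) x.
Proof. by move=> e e0; exists 0%N => k _; rewrite edistxx. Qed.

Lemma cvg_dot n (u v : nat -> 'rV[R]_n) x y :
  seq_cvg u x -> seq_cvg v y -> (fun k => dot (u k) (v k)) @ \oo --> dot x y.
Proof.
move=> /seq_cvg_coord ux /seq_cvg_coord vy.
apply: cvg_sum_real => i.
by apply: cvgM; [exact: ux|exact: vy].
Qed.

Lemma seq_cvgD n (u v : nat -> 'rV[R]_n) x y :
  seq_cvg u x -> seq_cvg v y -> seq_cvg (fun k => u k + v k) (x + y).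
Proof.
move=> /seq_cvg_coord ux /seq_cvg_coord vy; apply/seq_cvg_coord => i.
under eq_fun do rewrite mxE.
by rewrite mxE; apply: cvgD.
Qed.

Lemma seq_cvgZ n (a : nat -> R) (u : nat -> 'rV[R]_n) (b : R) x :
  a @ \oo --> b -> seq_cvg u x -> seq_cvg (fun k => a k *: u k) (b *: x).
Proof.
move=> ab /seq_cvg_coord ux; apply/seq_cvg_coord => i.
under eq_fun do rewrite mxE.
by rewrite mxE; apply: cvgM.
Qed.

Lemma seq_cvgN n (u : nat -> 'rV[R]_n) x :
  seq_cvg u x -> seq_cvg (fun k => - u k) (- x).
Proof.
move=> /seq_cvg_coord ux; apply/seq_cvg_coord => i.
under eq_fun do rewrite mxE.
by rewrite mxE; apply: cvgN.
Qed.

Lemma seq_cvgB n (u v : nat -> 'rV[R]_n) x y :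
  seq_cvg u x -> seq_cvg v y -> seq_cvg (fun k => u k - v k) (x - y).
Proof. by move=> ux /seq_cvgN; exact: seq_cvgD. Qed.

Lemma seq_cvg_sum n m (u : 'I_m -> nat -> 'rV[R]_n) x :
  (forall j, seq_cvg (u j) (x j)) ->
  seq_cvg (fun k => \sum_j u j k) (\sum_j x j).
Proof.
move=> ux; apply/seq_cvg_coord => i.
under eq_fun do rewrite summxE.
rewrite summxE.
apply: (@cvg_sum_real _ (fun j k => u j k 0 i) (fun j => x j 0 i)) => j.
by move/seq_cvg_coord : (ux j).
Qed.

Lemma seq_cvg_enorm n (u : nat -> 'rV[R]_n) x :
  seq_cvg u x -> (fun k => enorm (u k)) @ \oo --> enorm x.
Proof.
move=> ux; apply: (@continuous_cvg _ _ _ _ _ _ (@Num.sqrt R)).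
  exact: sqrt_continuous.
exact: cvg_dot.
Qed.

Lemma seq_cvg_unique n (u : nat -> 'rV[R]_n) x y :
  seq_cvg u x -> seq_cvg u y -> x = y.
Proof.
move=> /seq_cvg_coord ux /seq_cvg_coord uy; apply/rowP => i.
exact: (cvg_unique _ (ux i) (uy i)).
Qed.

Lemma increasing_ge_id (s : nat -> nat) k : increasing_seq s -> (k <= s k)%N.
Proof.
move=> /increasing_seqP s1; elim: k => // k; rewrite -ltnS => /leq_trans; apply.
exact: s1.
Qed.

Lemma cvg_subseq (s : nat -> nat) (a : nat -> R) (b : R) : increasing_seq s ->
  a @ \oo --> b -> (a \o s) @ \oo --> b.
Proof.
move=> si /cvgrPdist_lt ab; apply/cvgrPdist_lt => e /ab [N _ HN].
exists N => // k /= Nk; apply: HN => /=.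
by rewrite (leq_trans Nk)// increasing_ge_id.
Qed.

Lemma seq_cvg_subseq n (s : nat -> nat) (u : nat -> 'rV[R]_n) x :
  increasing_seq s -> seq_cvg u x -> seq_cvg (u \o s) x.
Proof.
move=> si ux e /ux[N HN]; exists N => k Nk; apply: HN.
by rewrite (leq_trans Nk)// increasing_ge_id.
Qed.

(** Bolzano-Weierstrass one coordinate at a time: the induction is on the number of leading
    coordinates that converge along the current subsequence. *)
Lemma bounded_seq_subseq n (u : nat -> 'rV[R]_n) (M : R) :
  (forall k, enorm (u k) <= M) ->
  exists2 s, increasing_seq s & exists x, seq_cvg (u \o s) x.
Proof.
move=> uM.
suff [s si sc] : exists2 s, increasing_seq s &
    forall i : 'I_n, (i < n)%N -> cvgn (fun k => u (s k) 0 i).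
  exists s => //; exists (\row_i limn (fun k => u (s k) 0 i)).
  by apply/seq_cvg_coord => i; rewrite mxE; exact/sc.
have : forall m, exists2 s, increasing_seq s &
    forall i : 'I_n, (i < m)%N -> cvgn (fun k => u (s k) 0 i); last exact.
elim=> [|m [s si sc]]; first by exists id.
have [mn|mn] := ltnP m n; last first.
  by exists s => // i _; apply: sc; rewrite (leq_trans (ltn_ord i)).
have [|t ti tc] := bolzano_weierstrass (u_ := fun k => u (s k) 0 (Ordinal mn)).
  exists M; split; first exact: num_real.
  by move=> x Mx k _ /=; rewrite (le_trans (coord_le_enorm _ _))// (le_trans (uM _))// ltW.
exists (s \o t) => [i j|i].
  exact: etrans (si (t i) (t j)) (ti i j).
rewrite ltnS leq_eqVlt => /orP[/eqP im|im].
  by have -> : i = Ordinal mn by exact/val_inj.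
apply/cvg_ex; exists (limn (fun k => u (s k) 0 i)).
exact: (cvg_subseq ti (sc i im)).
Qed.

(** The last hypothesis joins sequential closedness of [S] to continuity of [F] on it; compactness
    gives both the lower bound of [F] and the minimizer. *)
Lemma exists_minimizer n (S : set 'rV[R]_n) (F : 'rV[R]_n -> R) (M : R) :
  S !=set0 -> (forall x, S x -> enorm x <= M) ->
  (forall u x, (forall k, S (u k)) -> seq_cvg u x ->
     S x /\ (fun k => F (u k)) @ \oo --> F x) ->
  exists2 x, S x & forall y, S y -> F x <= F y.
Proof.
move=> [x0 Sx0] SM Scl.
have [lb|nlb] := pselect (has_lbound (F @` S)).
  have hi : has_inf (F @` S) by split => //; exists (F x0); exists x0.
  have /choice[u Hu] : forall k : nat, exists x, S x /\ F x < inf (F @` S) + k.+1%:R^-1.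
    move=> k; have [|y [x Sx <-] h] := @inf_adherent R (F @` S) k.+1%:R^-1 _ hi.
      by rewrite invr_gt0.
    by exists x.
  have [|s si [x ux]] := @bounded_seq_subseq n u M.
    by move=> k; apply: SM; exact: (Hu k).1.
  have [|Sx Fx] := Scl (u \o s) x _ ux; first by move=> k; exact: (Hu (s k)).1.
  exists x => // y Sy; apply: (@le_trans _ _ (inf (F @` S))); last first.
    by apply: ge_inf => //; exists y.
  have h : (fun k : nat => inf (F @` S) + k.+1%:R^-1) @ \oo --> inf (F @` S).
    rewrite -[X in _ --> X]addr0; apply: cvgD; first exact: cvg_cst.
    exact: cvg_harmonic.
  apply: ler_cvg_to Fx (cvg_subseq si h) _.
  by apply: nearW => k; rewrite ltW//; exact: (Hu (s k)).2.
(* If [F] were unbounded below, values below -k along a convergent subsequence would contradict the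
   convergence of [F] to a real number. *)
have /choice[u Hu] : forall k : nat, exists x, S x /\ F x < - k%:R.
  move=> k; apply: contrapT => /forallNP h; apply: nlb.
  exists (- k%:R) => _ [x Sx <-]; rewrite leNgt; apply/negP => Fx.
  by apply: (h x).
have [|s si [x ux]] := @bounded_seq_subseq n u M.
  by move=> k; apply: SM; exact: (Hu k).1.
have [|Sx Fx] := Scl (u \o s) x _ ux; first by move=> k; exact: (Hu (s k)).1.
have [N _ HN] : \forall k \near \oo, F x - 1 < F (u (s k)).
  by move/cvgr_gt : Fx; apply; rewrite ltrBlDr ltrDl.
pose k := maxn N (Num.bound `|F x - 1|).
have := HN k (leq_maxl _ _); have := (Hu (s k)).2.
have h1 : (k <= s k)%N by exact: increasing_ge_id.
have h2 : `|F x - 1| < (Num.bound `|F x - 1|)%:R by apply: archi_boundP; exact: normr_ge0.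
have h3 : (Num.bound `|F x - 1|)%:R <= (s k)%:R :> R.
  by rewrite ler_nat (leq_trans _ h1)// leq_maxr.
by move: h2; rewrite ltr_norml => /andP[h2 _] h4 h5; lra.
Qed.

End Sequences.

(** * Mean value inequalities and C^2 functions *)

Section MeanValue.
Variable R : realType.

(** The two hypotheses are continuity and a nonnegative lower right Dini derivative. The bound h 0 -
    e t <= h t holds at the supremum [T] of its solutions by continuity, and the one-sided
    inequality at [T] would push it further if T < 1. *)
Lemma dini_nondecreasing (h : R -> R) :
  (forall t, 0 <= t <= 1 -> forall e, 0 < e -> exists2 d, 0 < d &
     forall s, 0 <= s <= 1 -> `|s - t| < d -> `|h s - h t| <= e) ->
  (forall t, 0 <= t < 1 -> forall e, 0 < e -> exists2 d, 0 < d &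
     forall s, t < s <= 1 -> s < t + d -> h t - e * (s - t) <= h s) ->
  h 0 <= h 1.
Proof.
move=> hc hd; apply/ler_addgt0Pl => e e0.
pose A := [set t : R | 0 <= t <= 1 /\ h 0 - e * t <= h t].
have A0 : A 0 by split; rewrite ?lexx ?ler01// mulr0 subr0.
have Aub : has_ubound A by exists 1 => t [/andP[_ ?] _].
have As : has_sup A by split => //; exists 0.
pose T := sup A.
have T01 : 0 <= T <= 1.
  apply/andP; split; first exact: ub_le_sup.
  by apply: ge_sup; [exists 0|move=> t [/andP[_ ?] _]].
have AT : h 0 - e * T <= h T.
  apply/ler_addgt0Pl => e' e'0.
  have [d d0 Hd] := hc T T01 e' e'0.
  have [a [a01 ha] aT] := sup_adherent d0 As.
  have aleT : a <= T by apply: ub_le_sup.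
  have := Hd a a01; rewrite ler0_norm ?subr_le0// opprB ltrBlDr -ltrBlDl.
  move=> /(_ aT); rewrite ler_norml => /andP[_ h2].
  have : e * a <= e * T by rewrite ler_wpM2l// ltW.
  lra.
have [T1|T1] := ltP T 1; last first.
  have T_1 : T = 1 by apply/le_anti; rewrite T1; case/andP: T01 => _ ->.
  by move: AT; rewrite T_1; lra.
have [|d d0 Hd] := hd T _ e e0; first by case/andP: T01 => ->.
pose s := Num.min (T + d / 2) 1.
have sT : T < s by rewrite lt_min T1 andbT ltrDl divr_gt0.
have s1 : s <= 1 by rewrite ge_min lexx orbT.
have sd : s < T + d by rewrite gt_min; apply/orP; left; lra.
have := Hd s; rewrite sT s1 => /(_ isT sd) hs.
have : A s by split; [rewrite s1 andbT; case/andP: T01; lra|lra].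
by move=> /(ub_le_sup Aub); rewrite leNgt sT.
Qed.

Lemma mean_value_le (h D : R -> R) m :
  (forall t, 0 <= t <= 1 -> forall e, 0 < e -> exists2 d, 0 < d &
     forall s, 0 <= s <= 1 -> `|s - t| < d ->
       `|h s - h t - (s - t) * D t| <= e * `|s - t|) ->
  (forall t, 0 <= t <= 1 -> m <= D t) -> m <= h 1 - h 0.
Proof.
move=> hD Dm.
suff : h 0 - m * 0 <= h 1 - m * 1 by lra.
apply: (dini_nondecreasing (h := fun t => h t - m * t)) => t t01 e e0.
  have [d d0 Hd] := hD t t01 1 ltr01.
  pose c := 1 + `|D t| + `|m|.
  have c0 : 0 < c by rewrite /c -addrA ltr_wpDr ?addr_ge0.
  exists (Num.min d (e / c)); first by rewrite lt_min d0 divr_gt0.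
  move=> s s01; rewrite lt_min => /andP[sd se].
  have := Hd s s01 sd; rewrite mul1r => h1.
  have -> : h s - m * s - (h t - m * t) =
    (h s - h t - (s - t) * D t) + (s - t) * D t - m * (s - t) by ring.
  rewrite (le_trans (ler_normB _ _))//.
  rewrite (le_trans (lerD (ler_normD _ _) (lexx _)))// !normrM.
  move: se; rewrite ltr_pdivlMr// /c => se; lra.
have t01' : 0 <= t <= 1 by case/andP: t01 => -> /ltW.
have [d d0 Hd] := hD t t01' e e0.
exists d => // s /andP[ts s1] sd.
have st0 : 0 < s - t by rewrite subr_gt0.
have := Hd s; rewrite (gtr0_norm st0) => /(_ _ _)/wrap[||].
- by rewrite s1 andbT; case/andP: t01 => t0 _; rewrite (le_trans t0)// ltW.
- by rewrite ltrBlDl.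
rewrite ler_norml => /andP[h1 _].
have : (s - t) * m <= (s - t) * D t by rewrite ler_wpM2l ?Dm// ltW.
lra.
Qed.

(** [a] plays the role of the gradient along the segment. The lemma serves both for the entries of a
    gradient and for a Taylor remainder. *)
Lemma mean_value_segment n (h : 'rV[R]_n -> R) (a : 'rV[R]_n -> 'rV[R]_n) x w m :
  (forall t : R, 0 <= t <= 1 -> forall e : R, 0 < e -> exists2 d : R, 0 < d &
     forall u, edist u (x + t *: w) < d ->
       `|h u - h (x + t *: w) - dot (a (x + t *: w)) (u - (x + t *: w))|
         <= e * edist u (x + t *: w)) ->
  (forall t : R, 0 <= t <= 1 -> `|dot (a (x + t *: w)) w| <= m) ->
  `|h (x + w) - h x| <= m.
Proof.
move=> ha am.
pose c := enorm w + 1.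
have c0 : 0 < c by rewrite ltr_wpDl ?enorm_ge0.
have ew (s t : R) : edist (x + s *: w) (x + t *: w) = `|s - t| * enorm w.
  by rewrite /edist -enormZ; congr enorm; rewrite scalerBl opprD addrACA subrr add0r.
have key t : 0 <= t <= 1 -> forall e, 0 < e -> exists2 d, 0 < d &
     forall s, 0 <= s <= 1 -> `|s - t| < d ->
       `|h (x + s *: w) - h (x + t *: w) - (s - t) * dot (a (x + t *: w)) w|
         <= e * `|s - t|.
  move=> t01 e e0.
  have [d d0 Hd] := ha t t01 (e / c) (divr_gt0 e0 c0).
  exists (d / c); first exact: divr_gt0.
  move=> s s01; rewrite ltr_pdivlMr// => st.
  have st2 : `|s - t| * enorm w <= `|s - t| * c.
    by rewrite ler_wpM2l// lerDl.
  have := Hd (x + s *: w); rewrite ew => /(_ (le_lt_trans st2 st)).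
  have -> : x + s *: w - (x + t *: w) = (s - t) *: w.
    by rewrite scalerBl opprD addrACA subrr add0r.
  rewrite dotZr => /le_trans; apply.
  have ec : 0 < e / c by rewrite divr_gt0.
  have -> : e * `|s - t| = e / c * (`|s - t| * c).
    by field; rewrite gt_eqF.
  by rewrite ler_wpM2l// ltW.
rewrite ler_norml; apply/andP; split.
  have -> : h (x + w) - h x = h (x + (1:R) *: w) - h (x + (0:R) *: w).
    by rewrite scale1r scale0r addr0.
  apply: (mean_value_le (h := fun t => h (x + t *: w)) key) => t /am.
  by rewrite ler_norml => /andP[].
rewrite -lerN2.
have -> : - (h (x + w) - h x) = - h (x + (1:R) *: w) - - h (x + (0:R) *: w).
  by rewrite scale1r scale0r addr0; ring.
apply: (mean_value_le (h := fun t => - h (x + t *: w))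
    (D := fun t => - dot (a (x + t *: w)) w)) => [t t01 e e0|t /am].
  have [d d0 Hd] := key t t01 e e0; exists d => // s s01 std.
  by rewrite -normrN; have := Hd s s01 std; congr (`|_| <= _); ring.
by rewrite lerN2 ler_norml => /andP[].
Qed.

End MeanValue.

(** * Differentiability in Euclidean form and quantitative C^2 bounds *)

Section Smooth.
Variable R : realType.

Lemma diff_expand n p (G : 'rV[R]_n -> 'rV[R]_p) x : differentiable G x ->
  forall e : R, 0 < e -> exists2 d : R, 0 < d &
    forall u, edist u x < d ->
      enorm (G u - G x - 'd G x (u - x)) <= e * edist u x.
Proof.
move=> /diff_locally /eqaddoP dG e e0.
have p0 : 0 < p%:R + 1 :> R by rewrite ltr_wpDl.
have /nbhs_edist[d [d0 Hd]] := dG (e / (p%:R + 1)) (divr_gt0 e0 p0).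
exists d => // u ux; have := Hd (u - x).
rewrite /edist subr0 => /(_ ux).
rewrite !fctE /= subrK => H.
rewrite (le_trans (enorm_le_mx_norm _))//.
rewrite opprD addrA in H.
apply: (@le_trans _ _ ((p%:R + 1) * (e / (p%:R + 1) * `|u - x|))).
  by apply: ler_pM => //; rewrite lerDl.
rewrite mulrA mulrCA divff ?gt_eqF// mulr1 ler_wpM2l ?(ltW e0)//.
exact: mx_norm_le_enorm.
Qed.

Lemma grad_expand n (h : 'rV[R]_n -> R) x : differentiable h x ->
  forall e : R, 0 < e -> exists2 d : R, 0 < d &
    forall u, edist u x < d ->
      `|h u - h x - dot (grad h x) (u - x)| <= e * edist u x.
Proof.
move=> /diff_locally /eqaddoP dG e e0.
have /nbhs_edist[d [d0 Hd]] := dG e e0.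
exists d => // u ux; have := Hd (u - x).
rewrite /edist subr0 => /(_ ux).
rewrite !fctE /= subrK opprD addrA.
have -> : 'd h x (u - x) = dot (grad h x) (u - x).
  rewrite {1}(row_sum_e (u - x)) linear_sum /=; apply: eq_bigr => i _.
  by rewrite linearZ /= [grad h x 0 i]mxE mulrC.
move=> /le_trans; apply; rewrite ler_wpM2l ?(ltW e0)//.
exact: mx_norm_le_enorm.
Qed.

(** The quantitative content of C^2 smoothness: one [L] for the Taylor remainder and for the
    Lipschitz modulus of the gradient. Continuity of the second derivatives is spent on producing
    [L]; afterwards the Hessian is only taken at a point. *)
Definition C2_ball n (h : 'rV[R]_n -> R) (xbar : 'rV[R]_n) (r L : R) : Prop :=
  forall x, edist x xbar < r -> differentiable (grad h) x /\
  forall x', edist x' xbar < r ->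
    `|h x' - h x - dot (grad h x) (x' - x)| <= L * edist x' x ^+ 2 /\
    edist (grad h x') (grad h x) <= L * edist x' x.

Lemma C2_around_ball n (h : 'rV[R]_n -> R) xbar : C2_around h xbar ->
  exists r L, [/\ 0 < r, 0 <= L & C2_ball h xbar r L].
Proof.
move=> [D [Dop [Dx HD]]].
pose H u i j := 'd (grad h) u (e_ R j) 0 i.
have [r1 [r10 Hr1]] := Dop _ Dx.
(* [B + 1] strictly exceeds the modulus of every Hessian entry at [xbar], so by continuity it bounds
   all of them on a common ball. *)
pose B : R := \sum_i \sum_j (`|H xbar i j| + 1).
have [r2 [r20 Hr2]] : is_nbhd [set u | forall ij : 'I_n * 'I_n,
     `|H u ij.1 ij.2| < B + 1] xbar.
  apply/nbhs_edist.
  apply: (@filter_forall _ ('I_n * 'I_n)%type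
    (fun ij (u : 'rV[R]_n) => `|H u ij.1 ij.2| < B + 1) (nbhs xbar) _) => -[i j] /=.
  have [_ [_ /(_ i j) cH]] := HD _ Dx.
  have HB : `|H xbar i j| < B + 1.
    rewrite /B (bigD1 i)//= (bigD1 j)//=.
    have : 0 <= \sum_(j0 < n | j0 != j) (`|H xbar i j0| + 1).
      by apply: sumr_ge0 => k _; rewrite addr_ge0.
    have : 0 <= \sum_(i0 < n | i0 != i) \sum_j (`|H xbar i0 j| + 1).
      by apply: sumr_ge0 => k _; apply: sumr_ge0 => k' _; rewrite addr_ge0.
    lra.
  have : (fun u => `|H u i j|) @ xbar --> `|H xbar i j|.
    have cH' : (fun u => H u i j) @ xbar --> H xbar i j := cH.
    exact: (cvg_norm cH').
  by move=> /cvgr_lt; apply.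
pose r := Num.min r1 r2.
pose L := n%:R * (n%:R * (B + 1)).
have B1 : 0 <= B + 1.
  by rewrite addr_ge0// sumr_ge0// => i _; rewrite sumr_ge0// => j _; rewrite addr_ge0.
exists r, L; split; first by rewrite lt_min r10.
  by rewrite !mulr_ge0.
have Dr x : edist x xbar < r -> D x by rewrite lt_min => /andP[/Hr1].
have Hb x i (w : 'rV[R]_n) : edist x xbar < r ->
    `|dot (\row_j H x i j) w| <= n%:R * (B + 1) * enorm w.
  rewrite lt_min => /andP[_ /Hr2 /= HB].
  rewrite (le_trans (ler_norm_sum _ _ _))//.
  apply: (@le_trans _ _ (\sum_(j < n) (B + 1) * enorm w)).
    apply: ler_sum => j _; rewrite mxE normrM ler_pM//.
      by rewrite ltW//; exact: (HB (i, j)).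
    exact: coord_le_enorm.
  by rewrite sumr_const card_ord -[leLHS]mulr_natl mulrA.
have seg (x x' : 'rV[R]_n) t : edist x xbar < r -> edist x' xbar < r -> 0 <= t <= 1 ->
    edist (x + t *: (x' - x)) xbar < r.
  move=> xr xr' t01; have := dist_convex t01 xr' xr; congr (edist _ _ < _).
  by apply/rowP => i; rewrite !mxE; ring.
have lip x x' : edist x xbar < r -> edist x' xbar < r ->
    edist (grad h x') (grad h x) <= L * edist x' x.
  move=> xr xr'; rewrite /edist (le_trans (enorm_le_sum _))//.
  apply: (@le_trans _ _ (\sum_(i < n) n%:R * (B + 1) * edist x' x)); last first.
    by rewrite sumr_const card_ord -[leLHS]mulr_natl /L !mulrA.
  apply: ler_sum => i _; rewrite coordB.
  have := @mean_value_segment _ _ (fun u => grad h u 0 i) (fun u => \row_j H u i j)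
    x (x' - x) (n%:R * (B + 1) * edist x' x).
  rewrite subrKC; apply.
    move=> t t01 e e0.
    have zr := seg _ _ t xr xr' t01; set z := _ + _ in zr *.
    have [_ [/diff_expand /(_ e e0)[d d0 Hd] _]] := HD _ (Dr _ zr).
    exists d => // u /Hd; apply: le_trans.
    have := coord_le_enorm (grad h u - grad h z - 'd (grad h) z (u - z)) i.
    congr (_ <= _); congr (`| _ |).
    rewrite !coordB; congr (_ - _).
    rewrite {1}(row_sum_e (u - z)) linear_sum summxE; apply: eq_bigr => j _.
    by rewrite linearZ /= !mxE mulrC.
  move=> t t01; exact/Hb/seg.
move=> x xr; split; first by have [_ []] := HD _ (Dr _ xr).
move=> x' xr'; split; last exact: lip.
(* The remainder is the increment of u |-> h u - <grad h x, u>, whose gradient has norm at most L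
   |x' - x| along the segment. *)
have := @mean_value_segment _ _ (fun u => h u - dot (grad h x) u)
   (fun u => grad h u - grad h x) x (x' - x) (L * edist x' x ^+ 2).
rewrite subrKC => mv.
have -> : h x' - h x - dot (grad h x) (x' - x) =
   h x' - dot (grad h x) x' - (h x - dot (grad h x) x) by rewrite dotBr; ring.
apply: mv => t t01; have zr := seg _ _ t xr xr' t01; last first.
  rewrite (le_trans (cauchy_schwarz_abs _ _))// expr2 mulrA ler_wpM2r ?enorm_ge0//.
  have := lip _ _ xr zr; move=> /le_trans; apply.
  rewrite ler_wpM2l ?mulr_ge0// /edist [X in X - _]addrC addrK enormZ.
  case/andP: t01 => t0 t1; rewrite ger0_norm//.
  by rewrite ler_piMl ?enorm_ge0.
move=> e e0; move: (x + _) zr => z zr.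
have [/grad_expand /(_ e e0)[d d0 Hd] _] := HD _ (Dr _ zr).
exists d => // u /Hd; congr (`|_| <= _).
move: (grad h z) (grad h x) (h u) (h z) => a b c1 c2.
by rewrite (dotBl a b) !dotBr; ring.
Qed.

Lemma C2_ball_mono n (h : 'rV[R]_n -> R) xbar r L r' L' : r' <= r -> L <= L' ->
  C2_ball h xbar r L -> C2_ball h xbar r' L'.
Proof.
move=> rr LL H x xr; have [dh Hx] := H x (lt_le_trans xr rr); split => // x' xr'.
have [h1 h2] := Hx x' (lt_le_trans xr' rr); split.
  by rewrite (le_trans h1)// ler_wpM2r// sqr_ge0.
by rewrite (le_trans h2)// ler_wpM2r// edist_ge0.
Qed.

Lemma C2_around_ball_all n (I : finType) (h : I -> 'rV[R]_n -> R) xbar :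
  (forall i, C2_around (h i) xbar) ->
  exists r L, [/\ 0 < r, 0 <= L & forall i, C2_ball (h i) xbar r L].
Proof.
move=> hC.
have /choice[rL HrL] : forall i, exists rL : R * R,
    [/\ 0 < rL.1, 0 <= rL.2 & C2_ball (h i) xbar rL.1 rL.2].
  by move=> i; have [r [L H]] := C2_around_ball (hC i); exists (r, L).
have s0 (P : pred I) : 0 <= \sum_(i | P i) (rL i).1^-1.
  by apply: sumr_ge0 => i _; have [/ltW r0 _ _] := HrL i; rewrite invr_ge0.
(* Sums stand in for the minimum of the radii and the maximum of the constants, which also covers an
   empty family. *)
exists (1 + \sum_i (rL i).1^-1)^-1, (\sum_i (rL i).2); split.
- by rewrite invr_gt0 ltr_pwDl.
- by apply: sumr_ge0 => i _; have [] := HrL i.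
move=> i; have [r0 L0] := HrL i; apply: C2_ball_mono.
  rewrite -[leRHS]invrK lef_pV2 ?posrE ?invr_gt0// ?ltr_pwDl//.
  by rewrite (bigD1 i)//= addrCA lerDl addr_ge0.
rewrite (bigD1 i)//= lerDl; apply: sumr_ge0 => j _; have [] := HrL j => //.
Qed.

End Smooth.

(** * Closed convex sets: projection and normal cone *)

Section ConvexSets.
Variable R : realType.

Definition seq_closed n (A : set 'rV[R]_n) : Prop :=
  forall u x, (forall k, A (u k)) -> seq_cvg u x -> A x.

Lemma polyhedron_closed m (Theta : set 'rV[R]_m) :
  convex_polyhedron Theta -> seq_closed Theta.
Proof.
move=> [k [A [b ->]]] u x Au ux i /=.
apply: (ler_cvg_to (cvg_dot (seq_cvg_cst (row i A)) ux) (cvg_cst (b 0 i))).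
by apply: nearW => j; exact: Au.
Qed.

Lemma polyhedron_convex m (Theta : set 'rV[R]_m) :
  convex_polyhedron Theta -> is_convex_set Theta.
Proof.
move=> [k [A [b ->]]] x y t Ax Ay /andP[t0 t1] i /=.
rewrite dotDr !dotZr.
have := ler_wpM2l t0 (Ax i); have : 0 <= 1 - t by rewrite subr_ge0.
move=> /ler_wpM2l /(_ _ _ (Ay i)); lra.
Qed.

(** The limit t -> 0 of first-order arguments; the contradiction comes at t = min(t0, a / (2 (|b| +
    1))). *)
Lemma le0_of_le_small (a b t0 : R) : 0 < t0 ->
  (forall t, 0 < t <= t0 -> a <= t * b) -> a <= 0.
Proof.
move=> t00 H; rewrite leNgt; apply/negP => a0.
have c0 : 0 < `|b| + 1 by rewrite ltr_wpDl.
pose t := Num.min t0 (a / (`|b| + 1) / 2).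
have tp : 0 < t by rewrite lt_min t00 !divr_gt0.
have h1 : t <= a / (`|b| + 1) / 2 by rewrite ge_min lexx orbT.
have h2 : t * (`|b| + 1) <= a / 2.
  rewrite (le_trans (ler_wpM2r (ltW c0) h1))//.
  by rewrite mulrAC divfK// gt_eqF.
have h3 : t * b <= t * `|b| by rewrite ler_wpM2l ?ler_norm// ltW.
have := H t; rewrite tp ge_min lexx => /(_ isT); lra.
Qed.

Lemma projection_exists m (Theta : set 'rV[R]_m) z0 a :
  seq_closed Theta -> is_convex_set Theta -> Theta z0 ->
  exists p, [/\ Theta p, forall z, Theta z -> edist p a <= edist z a &
    normal_cone Theta p (a - p)].
Proof.
move=> Tcl Tcv Tz0.
have [| | |p [Tp pz0] pmin] := @exists_minimizer R m
  [set z | Theta z /\ edist z a <= edist z0 a] (fun z => edist z a)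
  (edist z0 a + enorm a).
- by exists z0.
- move=> x [_ xa]; rewrite -(subrK a x) (le_trans (enormD _ _))//.
  by rewrite lerD2r.
- move=> u x uS ux.
  have cv : (fun k => edist (u k) a) @ \oo --> edist x a.
    by apply: seq_cvg_enorm; apply: seq_cvgB => //; exact: seq_cvg_cst.
  split => //; split; first by apply: (Tcl u) => // k; exact: (uS k).1.
  apply: (ler_cvg_to cv (cvg_cst (edist z0 a))).
  by apply: nearW => k; exact: (uS k).2.
have pm z : Theta z -> edist p a <= edist z a.
  move=> Tz; have [za|za] := leP (edist z a) (edist z0 a).
    by apply: pmin.
  by rewrite (le_trans pz0)// ltW.
exists p; split => //; split => // z Tz.
(* The error term comes from |p - a + t (z - p)|^2 >= |p - a|^2, divided by 2 t. *)
apply: (@le0_of_le_small _ (dot (z - p) (z - p) / 2) 1) => // t /andP[t0 t1].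
have := pm (t *: z + (1 - t) *: p).
have -> : edist (t *: z + (1 - t) *: p) a = enorm (p - a + t *: (z - p)).
  by congr enorm; apply/rowP => i; rewrite !mxE; ring.
move=> /(_ _)/wrap[|h]; first by apply: Tcv => //; rewrite ltW.
have : edist p a ^+ 2 <= enorm (p - a + t *: (z - p)) ^+ 2.
  by rewrite lerXn2r// nnegrE ?edist_ge0 ?enorm_ge0.
rewrite sqr_enormD dotZr enormZ exprMn real_normK ?num_real// /edist.
rewrite -(opprB p a) dotNl -sqr_enorm.
set A := dot (p - a) (z - p); set B := enorm (z - p) ^+ 2 => h2.
have h3 : 0 <= t * (2 * A + t * B) by lra.
by move: h3; rewrite pmulr_rge0//; lra.
Qed.

Lemma normal_cone_closed m (Theta : set 'rV[R]_m) p y (ps ys : nat -> 'rV[R]_m) :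
  seq_closed Theta -> (forall k, normal_cone Theta (ps k) (ys k)) ->
  seq_cvg ps p -> seq_cvg ys y -> normal_cone Theta p y.
Proof.
move=> Tcl N psp ysy; split; first by apply: (Tcl ps) => // k; exact: (N k).1.
move=> z Tz.
have h := cvg_dot ysy (seq_cvgB (seq_cvg_cst z) psp).
apply: (ler_cvg_to h (cvg_cst (0:R))).
by apply: nearW => k; exact: (N k).2.
Qed.

End ConvexSets.

(** * Lipschitz, continuity and Taylor bounds on a fixed ball *)

Section BallCalculus.
Variable R : realType.

Lemma cvg_of_le_edist n (a : nat -> R) b c (u : nat -> 'rV[R]_n) x :
  (forall k, `|a k - b| <= c * edist (u k) x) -> seq_cvg u x -> a @ \oo --> b.
Proof.
move=> ab ux; apply/cvgrPdist_le => e e0.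
have c0 : 0 < `|c| + 1 by rewrite ltr_wpDl.
have [N HN] := ux (e / (`|c| + 1)) (divr_gt0 e0 c0).
exists N => // k /= Nk; rewrite distrC (le_trans (ab k))//.
have := HN k Nk; rewrite ltr_pdivlMr// => h.
apply: le_trans (ltW h); rewrite mulrC ler_wpM2l ?edist_ge0//.
by rewrite (le_trans (ler_norm _))// lerDl.
Qed.

Lemma seq_cvg_of_le_edist n p (a : nat -> 'rV[R]_p) b c (u : nat -> 'rV[R]_n) x :
  (forall k, edist (a k) b <= c * edist (u k) x) -> seq_cvg u x -> seq_cvg a b.
Proof.
move=> ab ux e e0.
have c0 : 0 < `|c| + 1 by rewrite ltr_wpDl.
have [N HN] := ux (e / (`|c| + 1)) (divr_gt0 e0 c0).
exists N => k Nk; rewrite (le_lt_trans (ab k))//.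
have := HN k Nk; rewrite ltr_pdivlMr// => h.
apply: le_lt_trans h; rewrite mulrC ler_wpM2l ?edist_ge0//.
by rewrite (le_trans (ler_norm _))// lerDl.
Qed.

Variables (n : nat) (xbar : 'rV[R]_n) (r L : R).
Hypothesis r0 : 0 < r.
Hypothesis L0 : 0 <= L.

Lemma C2_ball_lipschitz (h : 'rV[R]_n -> R) : C2_ball h xbar r L ->
  exists2 l, 0 <= l & forall x x', edist x xbar < r -> edist x' xbar < r ->
    `|h x' - h x| <= l * edist x' x.
Proof.
(* The first two terms bound the gradient on the ball; the last bounds the remainder per unit
   length, the diameter being 2 r. *)
move=> H; exists (enorm (grad h xbar) + L * r + L * (r + r)).
  by rewrite !addr_ge0 ?enorm_ge0 ?mulr_ge0 ?addr_ge0// ltW.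
move=> x x' xr x'r.
have [_ /(_ x' x'r)[h1 _]] := H x xr.
have x0r : edist xbar xbar < r by rewrite edistxx.
have [_ /(_ x xr)[_ h2]] := H xbar x0r.
have h3 : enorm (grad h x) <= enorm (grad h xbar) + L * r.
  rewrite -(subrK (grad h xbar) (grad h x)) addrC (le_trans (enormD _ _))//.
  by rewrite lerD2l (le_trans h2)// ler_wpM2l// ltW.
have h4 := cauchy_schwarz_abs (grad h x) (x' - x).
have h5 : edist x' x <= r + r.
  by rewrite (le_trans (edist_triangle xbar _ _))// lerD ?(ltW x'r)// edistC ltW.
have e0 := edist_ge0 x' x.
have -> : h x' - h x = (h x' - h x - dot (grad h x) (x' - x)) +
  dot (grad h x) (x' - x) by ring.
rewrite (le_trans (ler_normD _ _))// addrC mulrDl lerD//.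
  by rewrite (le_trans h4)// ler_wpM2r.
by rewrite (le_trans h1)// expr2 mulrA ler_wpM2r// ler_wpM2l.
Qed.

Lemma C2_ball_cvg (h : 'rV[R]_n -> R) (u : nat -> 'rV[R]_n) x : C2_ball h xbar r L ->
  (forall k, edist (u k) xbar < r) -> edist x xbar < r -> seq_cvg u x ->
  (fun k => h (u k)) @ \oo --> h x.
Proof.
move=> /C2_ball_lipschitz[l _ H] ur xr ux.
by apply: (cvg_of_le_edist (c := l) _ ux) => k; exact: H.
Qed.

Lemma C2_ball_grad_cvg (h : 'rV[R]_n -> R) (u : nat -> 'rV[R]_n) x : C2_ball h xbar r L ->
  (forall k, edist (u k) xbar < r) -> edist x xbar < r -> seq_cvg u x ->
  seq_cvg (fun k => grad h (u k)) (grad h x).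
Proof.
move=> H ur xr ux.
by apply: (seq_cvg_of_le_edist (c := L) _ ux) => k; exact: ((H _ xr).2 _ (ur k)).2.
Qed.

Variables (m : nat) (g : 'rV[R]_n -> 'rV[R]_m).
Hypothesis gC : forall j, C2_ball (comp_fun g j) xbar r L.

Lemma map_lipschitz :
  exists2 l, 0 <= l & forall x x', edist x xbar < r -> edist x' xbar < r ->
    edist (g x') (g x) <= l * edist x' x.
Proof.
have /choice[l Hl] : forall j, exists l, 0 <= l /\ forall x x',
    edist x xbar < r -> edist x' xbar < r ->
    `|g x' 0 j - g x 0 j| <= l * edist x' x.
  by move=> j; have [l l0 H] := C2_ball_lipschitz (gC j); exists l.
exists (\sum_j l j); first by apply: sumr_ge0 => j _; exact: (Hl j).1.
move=> x x' xr x'r; rewrite (le_trans (enorm_le_sum _))// mulr_suml.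
by apply: ler_sum => j _; rewrite !mxE; exact: (Hl j).2.
Qed.

Lemma map_cvg (u : nat -> 'rV[R]_n) x :
  (forall k, edist (u k) xbar < r) -> edist x xbar < r -> seq_cvg u x ->
  seq_cvg (fun k => g (u k)) (g x).
Proof.
move=> ur xr ux; have [l _ H] := map_lipschitz.
by apply: (seq_cvg_of_le_edist (c := l) _ ux) => k; exact: H.
Qed.

Lemma jac_adj_cvg (u : nat -> 'rV[R]_n) x (ys : nat -> 'rV[R]_m) y :
  (forall k, edist (u k) xbar < r) -> edist x xbar < r -> seq_cvg u x ->
  seq_cvg ys y -> seq_cvg (fun k => jac_adj g (u k) (ys k)) (jac_adj g x y).
Proof.
move=> ur xr ux ysy; apply: seq_cvg_sum => j; apply: seq_cvgZ.
  by move/seq_cvg_coord : ysy; exact.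
exact: C2_ball_grad_cvg.
Qed.

Lemma sum_coord_le (y : 'rV[R]_m) : \sum_j `|y 0 j| <= m%:R * enorm y.
Proof.
apply: (@le_trans _ _ (\sum_(j < m) enorm y)).
  by apply: ler_sum => j _; exact: coord_le_enorm.
by rewrite sumr_const card_ord mulr_natl.
Qed.

(** The error is linear in |y|, so the multiplier may vary: the error is uniform for bounded [y] and
    gains a factor when [y] tends to 0. The factor [m] compares the sum of coordinates with the
    Euclidean norm. *)
Lemma lagrangian_expand (y : 'rV[R]_m) x x' : edist x xbar < r -> edist x' xbar < r ->
  `|dot y (g x' - g x) - dot (jac_adj g x y) (x' - x)|
    <= L * (m%:R * enorm y) * edist x' x ^+ 2.
Proof.
move=> xr x'r; rewrite dot_suml -sumrB.
rewrite (le_trans (ler_norm_sum _ _ _))//.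
apply: (@le_trans _ _ (\sum_j `|y 0 j| * (L * edist x' x ^+ 2))); last first.
  rewrite -mulr_suml mulrCA mulrA ler_wpM2r ?sqr_ge0// ler_wpM2l//.
  exact: sum_coord_le.
apply: ler_sum => j _; rewrite dotZl -mulrBr normrM ler_wpM2l// !mxE.
by have [_ /(_ x' x'r)[]] := gC j xr.
Qed.

End BallCalculus.

(** * Multipliers *)

Section Multipliers.
Variables (R : realType) (n m : nat).
Variables (f : 'rV[R]_n -> R) (g : 'rV[R]_n -> 'rV[R]_m) (Theta : set 'rV[R]_m).
Variables (xbar : 'rV[R]_n) (r L kappa : R).
Hypothesis Tcl : seq_closed Theta.
Hypothesis Tcv : is_convex_set Theta.
Hypothesis r0 : 0 < r.
Hypothesis L0 : 0 <= L.
Hypothesis fC : C2_ball f xbar r L.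
Hypothesis gC : forall j, C2_ball (comp_fun g j) xbar r L.
Hypothesis kappa0 : 0 < kappa.
Hypothesis mscq : forall x, edist x xbar < r ->
  setdist x (feas g Theta) <= kappa * setdist (g x) Theta.

Let phi := phi_fun f g Theta.

Lemma phi_feas x : Theta (g x) -> phi x = (f x)%:E.
Proof. by move=> Tx; rewrite /phi /phi_fun asboolT. Qed.

Lemma phi_fin x : phi x \is a fin_num -> Theta (g x).
Proof. by rewrite /phi /phi_fun; case: asboolP. Qed.

Lemma reg_subdiff_phiP x v : reg_subdiff phi x v <-> Theta (g x) /\
  forall e : R, 0 < e -> exists d : R, 0 < d /\ forall u, edist u x < d ->
    Theta (g u) -> f x + dot v (u - x) - e * edist u x <= f u.
Proof.
split=> [[fx H]|[Tx H]].
  have Tx := phi_fin fx; split => // e /H[d [d0 Hd]]; exists d; split => // u ux Tu.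
  by have := Hd u ux; rewrite !phi_feas.
split; first by rewrite phi_feas.
move=> e /H[d [d0 Hd]]; exists d; split => // u ux.
rewrite phi_feas//= /phi /phi_fun; case: asboolP => [Tu|_]; last by rewrite leey.
by rewrite lee_fin Hd.
Qed.

Lemma setdist_le p (A : set 'rV[R]_p) x y : A y -> setdist x A <= edist x y.
Proof.
move=> Ay; apply: ge_inf; last by exists y.
by exists 0 => _ [z _ <-]; exact: edist_ge0.
Qed.

Lemma setdist_approx p (A : set 'rV[R]_p) x y e : A y -> 0 < e ->
  exists2 z, A z & edist x z < setdist x A + e.
Proof.
move=> Ay e0; have [|_ [z Az <-] h] := @inf_adherent R [set edist x z | z in A] e e0.
  split; first by exists (edist x y); exists y.
  by exists 0 => _ [z _ <-]; exact: edist_ge0.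
by exists z.
Qed.

(** Metric subregularity enters here. The infimum in [setdist] may not be attained, so [z'] is taken
    within a slack [e] below both bounds, whence the two factors 2; when either bound vanishes, [z]
    itself is feasible. *)
Lemma near_feasible x z p : Theta (g x) -> edist z xbar < r -> Theta p ->
  exists2 z', Theta (g z') &
    edist z' z <= 2 * kappa * edist p (g z) /\ edist z' z <= 2 * edist z x.
Proof.
move=> Tx zr Tp; have [d0|dn] := eqVneq (edist p (g z)) 0.
  exists z; last by rewrite edistxx !mulr_ge0 ?edist_ge0// ltW.
  suff <- : p = g z by [].
  by apply/eqP; rewrite -subr_eq0; apply/eqP; exact: enorm0_eq0.
have dp : 0 < edist p (g z) by rewrite lt_def dn edist_ge0.
have [zx0|zxn] := eqVneq (edist z x) 0.
  exists z; last by rewrite edistxx !mulr_ge0 ?edist_ge0// ltW.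
  suff -> : z = x by [].
  by apply/eqP; rewrite -subr_eq0; apply/eqP; exact: enorm0_eq0.
have zxp : 0 < edist z x by rewrite lt_def zxn edist_ge0.
pose e := Num.min (kappa * edist p (g z)) (edist z x).
have e0 : 0 < e by rewrite lt_min zxp mulr_gt0.
have [z' Tz' h] := @setdist_approx _ (feas g Theta) z x e Tx e0.
exists z' => //; rewrite edistC.
have h1 : setdist z (feas g Theta) <= edist z x by exact: setdist_le.
have h2 : setdist (g z) Theta <= edist p (g z) by rewrite edistC; exact: setdist_le.
have h3 : setdist z (feas g Theta) <= kappa * edist p (g z).
  by rewrite (le_trans (mscq zr))// ler_wpM2l// ltW.
have e1 : e <= kappa * edist p (g z) by rewrite ge_min lexx.
have e2 : e <= edist z x by rewrite ge_min lexx orbT.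
split; lra.
Qed.

(* Exact penalization: z minimizes f - <v, .> + 2 e |. - x| + k/2 dist (g .) Theta ^ 2
   over a small ball around x, with k large, and y = k (g z - p) where p is the
   projection of g z on Theta.  Comparing z with a nearby feasible point given by the
   subregularity of g bounds k dist (g z) Theta, hence y, independently of e. *)
Lemma fuzzy_multiplier : exists2 C, 0 < C & forall x v e,
  edist x xbar < r / 2 -> enorm v <= 1 -> reg_subdiff phi x v -> 0 < e <= 1 ->
  exists z p y, [/\ edist z x <= e, edist p (g z) <= e, normal_cone Theta p y,
    enorm y <= C & edist (grad f z + jac_adj g z y) v <= 2 * e].
Proof.
have [l l0 fl] := C2_ball_lipschitz r0 L0 fC.
have [lg lg0 gl] := map_lipschitz r0 L0 gC.
(* Passing from z to z' costs at most l |z' - z| in f, |z' - z| in the tilt as |v| <= 1, and e |z' -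
   z| with e <= 1 in the subgradient error; moreover |z' - z| <= 2 kappa [D z]. *)
pose C1 := (l + 2) * (2 * kappa).
have C10 : 0 < C1 by rewrite !mulr_gt0// ltr_wpDl.
exists (2 * C1); first by rewrite mulr_gt0.
move=> x v e xr v1 /reg_subdiff_phiP[Tx Hv] /andP[e0 e1].
have [d0 [d00 Hd0]] := Hv e e0.
pose d := Num.min (Num.min (d0 / 4) (r / 8)) e.
have dp : 0 < d by rewrite !lt_min !divr_gt0.
have dd0 : d <= d0 / 4 by rewrite !ge_min lexx.
have dr : d <= r / 8 by rewrite !ge_min lexx orbT.
have de : d <= e by rewrite !ge_min lexx orbT.
(* Chosen so that k D <= 2 C1 forces C1 D < e d, which by [key] puts z in the interior of the ball
   of radius [d]. *)
pose k := (2 * C1 ^+ 2 + 1) / (e * d).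
have ed0 : 0 < e * d by rewrite mulr_gt0.
have k0 : 0 < k by rewrite divr_gt0// ltr_wpDl// mulr_ge0// sqr_ge0.
have ked : k * (e * d) = 2 * C1 ^+ 2 + 1 by rewrite divfK// gt_eqF.
have /choice[P HP] := fun a => projection_exists a Tcl Tcv Tx.
pose D z := edist (P (g z)) (g z).
have ball_r z : edist z x <= 4 * d -> edist z xbar < r.
  move=> zx; rewrite (le_lt_trans (edist_triangle x _ _))//; lra.
pose F z := f z - dot v z + 2 * e * edist z x + k / 2 * D z ^+ 2.
have [| | |z zx zmin] := @exists_minimizer R n [set z | edist z x <= d] F (d + enorm x).
- by exists x; rewrite /= edistxx ltW.
- move=> z zx; rewrite -(subrK x z) (le_trans (enormD _ _))//.
  by rewrite lerD2r.
- move=> u z ud uz.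
  have zx : edist z x <= d.
    apply: (ler_cvg_to (seq_cvg_enorm (seq_cvgB uz (seq_cvg_cst x))) (cvg_cst d)).
    by apply: nearW.
  have ur j : edist (u j) xbar < r by apply: ball_r; rewrite (le_trans (ud j))//; lra.
  have zr : edist z xbar < r by apply: ball_r; lra.
  split => //; rewrite /F; apply: cvgD; first (apply: cvgD; first apply: cvgB).
  + exact: (C2_ball_cvg r0 L0 fC).
  + exact: cvg_dot (seq_cvg_cst _) uz.
  + apply: cvgM; first exact: cvg_cst.
    exact: seq_cvg_enorm (seq_cvgB uz (seq_cvg_cst x)).
  + apply: cvgM; first exact: cvg_cst.
    have DD : (fun j => D (u j)) @ \oo --> D z.
      apply: (cvg_of_le_edist (c := lg) _ uz) => j.
      have [_ Pu _] := HP (g (u j)); have [_ Pz _] := HP (g z).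
      have h := gl _ _ zr (ur j).
      rewrite ler_norml /D; apply/andP; split.
        rewrite lerNl opprB lerBlDr.
        rewrite (le_trans (Pz _ (let: And3 a _ _ := HP (g (u j)) in a)))//.
        rewrite (le_trans (edist_triangle (g (u j)) _ _))// addrC.
        by rewrite lerD2r.
      rewrite lerBlDr.
      rewrite (le_trans (Pu _ (let: And3 a _ _ := HP (g z) in a)))//.
      rewrite (le_trans (edist_triangle (g z) _ _))// addrC.
      by rewrite lerD2r edistC.
    by under eq_fun do rewrite expr2; rewrite expr2; apply: cvgM.
rewrite /= in zx.
have zr : edist z xbar < r by apply: ball_r; lra.
have [TP _ NP] := HP (g z).
have [z' Tz' [z'1 z'2]] := near_feasible Tx zr TP.
rewrite -/(D z) in z'1.
have D0 : 0 <= D z by exact: edist_ge0.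
have z'x : edist z' x <= 3 * d.
  rewrite (le_trans (edist_triangle z _ _))//; lra.
have z'r : edist z' xbar < r by apply: ball_r; lra.
(* Minimality against [x] is combined with the subgradient inequality at the feasible [z']. The
   weight 2 e in [F] absorbs the error e |z - x| and leaves another e |z - x| on the left. *)
have key : k / 2 * D z ^+ 2 + e * edist z x <= C1 * D z.
  have h1 : edist z' x < d0 by lra.
  have {}h1 := Hd0 z' h1 Tz'.
  have h2 := fl _ _ zr z'r; rewrite ler_norml in h2; case/andP: h2 => _ h2.
  have h3 := zmin x; rewrite /= edistxx in h3; have {}h3 := h3 (ltW dp).
  rewrite /F edistxx mulr0 in h3.
  have Dx : D x = 0.
    have [_ /(_ _ Tx) + _] := HP (g x); rewrite edistxx => h.
    by apply/le_anti; rewrite h edist_ge0.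
  rewrite Dx expr0n mulr0 !addr0 in h3.
  have h4 := cauchy_schwarzN v (z' - z).
  have h5 : enorm v * enorm (z' - z) <= edist z' z by rewrite ler_piMl ?enorm_ge0.
  have h6 := edist_triangle z z' x.
  have h7 : e * edist z' x <= e * edist z' z + e * edist z x.
    by rewrite -mulrDr ler_wpM2l// ltW.
  have h8 : e * edist z' z <= edist z' z by rewrite ler_piMl ?edist_ge0.
  have h9 : (l + 2) * edist z' z <= C1 * D z.
    by rewrite /C1 -mulrA ler_wpM2l// addr_ge0.
  rewrite !dotBr in h1 h4; lra.
have kD : k * D z <= 2 * C1.
  have [Dz0|Dz0] := eqVneq (D z) 0; first by rewrite Dz0 mulr0 mulr_ge0// ltW.
  have Dzp : 0 < D z by rewrite lt_def Dz0.
  have h : k / 2 * D z ^+ 2 <= C1 * D z.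
    by apply: le_trans key; rewrite lerDl mulr_ge0 ?edist_ge0// ltW.
  have {}h : (k * D z) * D z <= (2 * C1) * D z by lra.
  by rewrite ler_pM2r in h.
have h10 : C1 * D z * k <= 2 * C1 ^+ 2.
  have -> : 2 * C1 ^+ 2 = C1 * (2 * C1) by ring.
  by rewrite -mulrA (mulrC (D z)) ler_pM2l.
have D_lt : C1 * D z < e * d.
  rewrite -(ltr_pM2r k0) (mulrC _ k) (mulrC (e * d)) ked (mulrC k); lra.
have zxd : edist z x < d.
  rewrite -(ltr_pM2l e0); apply: le_lt_trans D_lt.
  by apply: le_trans key; rewrite lerDr mulr_ge0 ?sqr_ge0// divr_ge0// ltW.
(* Otherwise k e d <= k D <= 2 C1, while k e d = 2 C1^2 + 1 exceeds 2 C1. *)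
have De : D z <= e.
  rewrite leNgt; apply/negP => eD.
  have h : k * (e * d) <= 2 * C1.
    apply: le_trans kD; rewrite ler_wpM2l ?(ltW k0)//.
    rewrite (le_trans _ (ltW eD))// ler_piMr ?(ltW e0)//; lra.
  rewrite ked in h; have := sqr_ge0 (C1 - 1 / 2); rewrite sqrrB; lra.
exists z, (P (g z)), (k *: (g z - P (g z))); split => //.
- by rewrite (le_trans zx).
- split => // w Tw; rewrite dotZl pmulr_rle0//; exact: NP.2.
- by rewrite enormZ gtr0_norm// enormBC.
set y := k *: _.
(* Approximate stationarity: z is compared with w = z - t a. Bounding [D w] by the distance from g w
   to the old projection P (g z) replaces the distance to [Theta] by a smooth function, with an
   inequality in the useful direction. *)
pose a := grad f z + jac_adj g z y - v.
rewrite /edist -/a.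
have a0 := enorm_ge0 a.
have [->|an] := eqVneq (enorm a) 0; first by rewrite mulr_ge0// ltW.
have ap : 0 < enorm a by rewrite lt_def an.
suff : enorm a ^+ 2 - 2 * e * enorm a <= 0.
  by rewrite expr2 -mulrBl pmulr_lle0// subr_le0.
pose K := (L + L * (m%:R * enorm y) + k / 2 * lg ^+ 2) * enorm a ^+ 2.
pose t0 := (d - edist z x) / enorm a.
have t00 : 0 < t0 by rewrite divr_gt0// subr_gt0.
apply: (@le0_of_le_small _ _ K t0) => // t /andP[tp tt0].
pose w := z - t *: a.
have wz : edist w z = t * enorm a.
  by rewrite /edist /w addrC addKr enormN enormZ gtr0_norm.
have wx : edist w x <= edist z x + t * enorm a.
  by rewrite (le_trans (edist_triangle z _ _))// wz addrC.
have wd : edist w x <= d.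
  rewrite (le_trans wx)//.
  have : t * enorm a <= t0 * enorm a by rewrite ler_pM2r.
  rewrite /t0 divfK ?gt_eqF//; lra.
have wr : edist w xbar < r by apply: ball_r; rewrite (le_trans wd)//; lra.
have h1 := zmin w wd; rewrite /F in h1.
have h2 : D w ^+ 2 <= edist (P (g z)) (g w) ^+ 2.
  have [_ Pw _] := HP (g w).
  by rewrite lerXn2r ?nnegrE ?edist_ge0//; exact: Pw.
have h3 : edist (P (g z)) (g w) ^+ 2 =
    D z ^+ 2 + 2 * dot (g z - P (g z)) (g w - g z) + edist (g w) (g z) ^+ 2.
  rewrite edistC /D (edistC (P _)) /edist -sqr_enormD.
  by congr (enorm _ ^+ 2); apply/rowP => i; rewrite !mxE; ring.
have h4 : edist (g w) (g z) ^+ 2 <= lg ^+ 2 * (t * enorm a) ^+ 2.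
  rewrite -exprMn -wz lerXn2r ?nnegrE ?edist_ge0 ?mulr_ge0 ?edist_ge0//.
  exact: gl.
have h5 := lagrangian_expand L0 gC y zr wr.
rewrite wz ler_norml dotZl in h5; case/andP: h5 => _ h5.
have [_ /(_ w wr)[h6 _]] := fC zr.
rewrite wz ler_norml in h6; case/andP: h6 => _ h6.
have wzE : w - z = - (t *: a) by rewrite /w addrC addKr.
have h7 : dot (grad f z) (w - z) + dot (jac_adj g z y) (w - z) - dot v (w - z)
    = - (t * enorm a ^+ 2).
  rewrite -dotDl -dotBl -/a wzE dotNr dotZr sqr_enorm //.
have h8 : dot v w - dot v z = dot v (w - z) by rewrite dotBr.
have h9 : 2 * e * edist w x <= 2 * e * (edist z x + t * enorm a).
  by rewrite ler_pM2l// mulr_gt0.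
have h11 : k / 2 * D w ^+ 2 <= k / 2 * (D z ^+ 2 +
    2 * dot (g z - P (g z)) (g w - g z) + lg ^+ 2 * (t * enorm a) ^+ 2).
  apply: ler_wpM2l; first by rewrite divr_ge0// ltW.
  lra.
have h12 : t * (enorm a ^+ 2 - 2 * e * enorm a) <= t * (t * K).
  rewrite /K; lra.
by rewrite ler_pM2l in h12.
Qed.

(** Limit of the fuzzy multipliers as e tends to 0: the bound [C] gives a convergent subsequence,
    and the normal cone has a closed graph. *)
Lemma bounded_multiplier : exists2 C, 0 < C & forall x v,
  edist x xbar < r / 2 -> enorm v <= 1 -> reg_subdiff phi x v ->
  exists2 y, Lambda f g Theta x v y & enorm y <= C.
Proof.
have [C C0 H] := fuzzy_multiplier.
exists C => // x v xr v1 Hv.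
have /choice[z Hz] : forall k : nat, exists z, exists p y,
   [/\ edist z x <= k.+1%:R^-1, edist p (g z) <= k.+1%:R^-1, normal_cone Theta p y,
    enorm y <= C & edist (grad f z + jac_adj g z y) v <= 2 * k.+1%:R^-1] /\
    edist z xbar < r.
  move=> k.
  have e0 : 0 < Num.min (r / 2) k.+1%:R^-1 by rewrite lt_min divr_gt0//= invr_gt0.
  have [|z [p [y [zx pz N yC yv]]]] := H x v (Num.min (r / 2) k.+1%:R^-1) xr v1 Hv.
    rewrite e0 ge_min; apply/orP; right.
    by rewrite invf_le1// ler1n.
  rewrite !le_min in zx pz.
  case/andP: zx => zx1 zx2; case/andP: pz => _ pz.
  exists z, p, y; split; last first.
    by rewrite (le_lt_trans (edist_triangle x _ _))//; lra.
  split => //; rewrite (le_trans yv)// ler_pM2l// ge_min lexx orbT //.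
have /choice[p Hp] := Hz; have /choice[y Hy] := Hp.
have inv0 q (a : nat -> 'rV[R]_q) b (c : R) :
    (forall k, edist (a k) b <= c * k.+1%:R^-1) -> seq_cvg a b.
  move=> ab e e0.
  have hc : (fun k : nat => c * k.+1%:R^-1) @ \oo --> c * 0.
    by apply: cvgM; [exact: cvg_cst|exact: cvg_harmonic].
  rewrite mulr0 in hc.
  move/cvgr_lt : hc => /(_ _ e0)[N _ HN]; exists N => k Nk.
  by rewrite (le_lt_trans (ab k))//; exact: HN.
have zx : seq_cvg z x.
  by apply: (inv0 _ _ _ 1) => k; rewrite mul1r; have [[]] := Hy k.
have zr k : edist (z k) xbar < r by have [] := Hy k.
have xr' : edist x xbar < r by have h0 := r0; lra.
have pg : seq_cvg p (g x).
  have h : seq_cvg (fun k => p k - g (z k)) 0.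
    apply: (inv0 _ _ _ 1) => k; rewrite mul1r /edist subr0.
    by have [[]] := Hy k.
  have := seq_cvgD h (map_cvg r0 L0 gC zr xr' zx).
  by under eq_fun do rewrite subrK; rewrite add0r.
have [|s si [y0 sy]] := @bounded_seq_subseq R m y C.
  by move=> k; have [[]] := Hy k.
exists y0; last first.
  apply: (ler_cvg_to (seq_cvg_enorm sy) (cvg_cst C)).
  by apply: nearW => k; have [[]] := Hy (s k).
have zsx := seq_cvg_subseq si zx.
split; last first.
  apply: (normal_cone_closed Tcl _ (seq_cvg_subseq si pg) sy) => k.
  by have [[]] := Hy (s k).
apply: (@seq_cvg_unique _ _ (fun k => grad f (z (s k)) + jac_adj g (z (s k)) (y (s k)))).
  apply: (@seq_cvg_subseq _ _ s (fun k => grad f (z k) + jac_adj g (z k) (y k))) => //.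
  by apply: (inv0 _ _ _ 2) => k; have [[]] := Hy k.
apply: seq_cvgD.
  exact: (C2_ball_grad_cvg fC (fun k => zr (s k)) xr' zsx).
exact: (jac_adj_cvg gC (fun k => zr (s k)) xr' zsx sy).
Qed.

(** Since y is normal, <y, g x' - g x> <= 0, and only the Taylor remainders of f and of <y, g> are
    left. Their total constant [K] is doubled because of the factor rho / 2, and 1 is added to get
    rho > 0. *)
Lemma hypomonotone C : 0 <= C -> exists2 rho, 0 < rho & forall x x' v y,
  edist x xbar < r -> edist x' xbar < r -> Theta (g x') ->
  Lambda f g Theta x v y -> enorm y <= C ->
  f x + dot v (x' - x) - rho / 2 * edist x' x ^+ 2 <= f x'.
Proof.
move=> C0; pose K := L + L * (m%:R * C).
have K0 : 0 <= K by rewrite addr_ge0// !mulr_ge0.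
exists (2 * K + 1); first by rewrite ltr_wpDl// mulr_ge0.
move=> x x' v y xr x'r Tx' [-> [_ Ny]] yC.
have [_ /(_ x' x'r)[h1 _]] := fC xr.
have h2 := lagrangian_expand L0 gC y xr x'r.
have h3 := Ny _ Tx'.
have s0 := sqr_ge0 (edist x' x).
have h4 : L * (m%:R * enorm y) * edist x' x ^+ 2 <= L * (m%:R * C) * edist x' x ^+ 2.
  by rewrite ler_wpM2r// ler_wpM2l// ler_wpM2l.
rewrite !ler_norml in h1 h2; case/andP: h1 => h1 _; case/andP: h2 => h2 _.
rewrite dotDl /K; lra.
Qed.

Lemma reg_subdiff_of_quadratic x v rho d : Theta (g x) -> 0 < d ->
  (forall u, edist u x < d -> Theta (g u) ->
     f x + dot v (u - x) - rho * edist u x ^+ 2 <= f u) ->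
  reg_subdiff phi x v.
Proof.
move=> Tx d0 H; apply/reg_subdiff_phiP; split => // e e0.
have c0 : 0 < `|rho| + 1 by rewrite ltr_wpDl.
exists (Num.min d (e / (`|rho| + 1))); split; first by rewrite lt_min d0 divr_gt0.
move=> u; rewrite lt_min => /andP[ud ue] Tu; apply: le_trans (H u ud Tu).
rewrite lerD2l lerN2 expr2 mulrA ler_wpM2r ?edist_ge0//.
rewrite ltr_pdivlMr// in ue; apply: le_trans (ltW ue).
rewrite mulrC ler_wpM2l ?edist_ge0// (le_trans (ler_norm _))// lerDl//.
Qed.

End Multipliers.

(** * Limits of difference quotients along the graph of the subdifferential *)

Section TangentLimit.
Variables (R : realType) (n m : nat).
Variables (f : 'rV[R]_n -> R) (g : 'rV[R]_n -> 'rV[R]_m) (Theta : set 'rV[R]_m).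
Variables (xbar : 'rV[R]_n) (r L : R).
Hypothesis Tcl : seq_closed Theta.
Hypothesis r0 : 0 < r.
Hypothesis L0 : 0 <= L.
Hypothesis fC : C2_ball f xbar r L.
Hypothesis gC : forall j, C2_ball (comp_fun g j) xbar r L.

Lemma seq_cvg_diff (h : 'rV[R]_n -> R) x (ps : nat -> 'rV[R]_n) p :
  seq_cvg ps p -> seq_cvg (fun k => 'd (grad h) x (ps k)) ('d (grad h) x p).
Proof.
move=> psp.
have E w : 'd (grad h) x w = \sum_i w 0 i *: 'd (grad h) x (e_ R i).
  rewrite {1}(row_sum_e w) linear_sum; apply: eq_bigr => i _.
  by rewrite linearZ.
rewrite E; under eq_fun do rewrite E.
apply: seq_cvg_sum => i; apply: seq_cvgZ; last exact: seq_cvg_cst.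
by move/seq_cvg_coord : psp; exact.
Qed.

(** Frechet differentiability lets the direction vary with k, since the [ps k] are eventually
    bounded by |p| + 1. *)
Lemma seq_cvg_grad_quotient (h : 'rV[R]_n -> R) x (ts : nat -> R)
    (ps : nat -> 'rV[R]_n) p :
  differentiable (grad h) x -> (forall k, 0 < ts k) -> ts @ \oo --> (0:R) ->
  seq_cvg ps p ->
  seq_cvg (fun k => (ts k)^-1 *: (grad h (x + ts k *: ps k) - grad h x))
    ('d (grad h) x p).
Proof.
move=> dh t0 tcv psp.
have xs : seq_cvg (fun k => x + ts k *: ps k) x.
  rewrite -[X in seq_cvg _ X]addr0 -(scale0r p).
  by apply: seq_cvgD; [exact: seq_cvg_cst|exact: seq_cvgZ].
suff : seq_cvg (fun k => (ts k)^-1 *: (grad h (x + ts k *: ps k) - grad h x)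
    - 'd (grad h) x (ps k)) 0.
  move=> /seq_cvgD /(_ (seq_cvg_diff h x psp)).
  by under eq_fun do rewrite subrK; rewrite add0r.
move=> e e0.
pose M := enorm p + 1.
have M0 : 0 < M by rewrite ltr_wpDl ?enorm_ge0.
have [d d0 Hd] := diff_expand dh (divr_gt0 e0 (mulr_gt0 (ltr0n R 2) M0)).
have [N1 HN1] := xs _ d0.
have /cvgr_lt /(_ M)[] := seq_cvg_enorm psp; first by rewrite ltrDl.
move=> N2 _ HN2.
exists (maxn N1 N2) => k; rewrite geq_max => /andP[k1 k2].
have h1 := Hd _ (HN1 k k1); have h2 := HN2 k k2; rewrite /= in h2.
rewrite /edist subr0.
have tk := t0 k.
rewrite [X in 'd _ _ X]addrC addKr linearZ /= in h1.
have -> : (ts k)^-1 *: (grad h (x + ts k *: ps k) - grad h x) - 'd (grad h) x (ps k)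
    = (ts k)^-1 *: (grad h (x + ts k *: ps k) - grad h x - ts k *: 'd (grad h) x (ps k)).
  by rewrite [RHS]scalerBr scalerA mulVf ?gt_eqF// scale1r.
rewrite enormZ gtr0_norm ?invr_gt0// mulrC ltr_pdivrMr//.
apply: le_lt_trans h1 _.
rewrite /edist [X in enorm X]addrC addKr enormZ gtr0_norm//.
rewrite mulrCA [ltRHS]mulrC ltr_pM2l//.
rewrite mulrAC ltr_pdivrMr ?mulr_gt0// ltr_pM2l//.
lra.
Qed.

Lemma jac_adjB x (y z : 'rV[R]_m) :
  jac_adj g x (y - z) = jac_adj g x y - jac_adj g x z.
Proof. by rewrite /jac_adj -sumrB; apply: eq_bigr => j _; rewrite coordB scalerBl. Qed.

(* Only one inequality of the formula for the graphical derivative of the subdifferential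
   is needed, and it does not use polyhedrality: the first-order term
   <ys k - y, g (x_k) - g x> is nonnegative because the normal cone is monotone, and the
   curvature of g enters it only with the factor ys k - y, which tends to 0. *)
Lemma second_order_tangent (x v p q : 'rV[R]_n) (y : 'rV[R]_m) (ts : nat -> R)
    (ps qs : nat -> 'rV[R]_n) (ys : nat -> 'rV[R]_m) :
  edist x xbar < r -> (forall k, edist (x + ts k *: ps k) xbar < r) ->
  (forall k, 0 < ts k) -> ts @ \oo --> (0:R) ->
  seq_cvg ps p -> seq_cvg qs q -> seq_cvg ys y ->
  (forall k, Lambda f g Theta (x + ts k *: ps k) (v + ts k *: qs k) (ys k)) ->
  Theta (g x) ->
  [/\ critical_cone (feas g Theta) x (v - grad f x) p, Lambda f g Theta x v y &
    hessq f x p + hessq_yg g y x p <= dot q p].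
Proof.
move=> xr xsr t0 tcv psp qsq ysy LA Tx.
have xs : seq_cvg (fun k => x + ts k *: ps k) x.
  rewrite -[X in seq_cvg _ X]addr0 -(scale0r p).
  by apply: seq_cvgD; [exact: seq_cvg_cst|exact: seq_cvgZ].
have vs : seq_cvg (fun k => v + ts k *: qs k) v.
  rewrite -[X in seq_cvg _ X]addr0 -(scale0r q).
  by apply: seq_cvgD; [exact: seq_cvg_cst|exact: seq_cvgZ].
have Ny : normal_cone Theta (g x) y.
  apply: (normal_cone_closed Tcl _ (map_cvg r0 L0 gC xsr xr xs) ysy) => k.
  exact: (LA k).2.
have vE : v = grad f x + jac_adj g x y.
  apply: (seq_cvg_unique vs).
  have -> : (fun k => v + ts k *: qs k) = (fun k => grad f (x + ts k *: ps k)
      + jac_adj g (x + ts k *: ps k) (ys k)) by apply/funext => k; exact: (LA k).1.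
  apply: seq_cvgD; first exact: (C2_ball_grad_cvg fC).
  exact: (jac_adj_cvg gC).
pose G k := g (x + ts k *: ps k) - g x.
have nrm k : edist (x + ts k *: ps k) x = ts k * enorm (ps k).
  by rewrite /edist [X in enorm X]addrC addKr enormZ gtr0_norm.
have step k : x + ts k *: ps k - x = ts k *: ps k by rewrite [LHS]addrC addKr.
have expand z k : `|(ts k)^-1 * dot z (G k) - dot (jac_adj g x z) (ps k)| <=
    L * (m%:R * enorm z) * (ts k * enorm (ps k) ^+ 2).
  have := lagrangian_expand L0 gC z xr (xsr k).
  rewrite -/(G k) nrm step dotZr => h.
  have tk := t0 k.
  have -> : (ts k)^-1 * dot z (G k) - dot (jac_adj g x z) (ps k) =
     (ts k)^-1 * (dot z (G k) - ts k * dot (jac_adj g x z) (ps k)).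
    by rewrite mulrBr mulKf ?gt_eqF.
  rewrite normrM gtr0_norm ?invr_gt0// ler_pdivrMl//.
  by apply: le_trans h _; rewrite le_eqVlt; apply/orP; left; apply/eqP; ring.
have err0 (zs : nat -> 'rV[R]_m) z : seq_cvg zs z ->
    (fun k => L * (m%:R * enorm (zs k)) * (ts k * enorm (ps k) ^+ 2)) @ \oo --> (0:R).
  move=> zsz.
  have -> : 0 = L * (m%:R * enorm z) * (0 * enorm p ^+ 2) :> R by rewrite mul0r mulr0.
  apply: cvgM; first apply: cvgM; first exact: cvg_cst.
    by apply: cvgM; [exact: cvg_cst|exact: seq_cvg_enorm].
  apply: cvgM => //; under eq_fun do rewrite expr2; rewrite expr2.
  by apply: cvgM; exact: seq_cvg_enorm.
have Jp (zs : nat -> 'rV[R]_m) z : seq_cvg zs z ->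
    (fun k => dot (jac_adj g x (zs k)) (ps k)) @ \oo --> dot (jac_adj g x z) p.
  move=> zsz; apply: cvg_dot => //.
  apply: (@jac_adj_cvg _ _ xbar r L m g gC (fun=> x) x zs z) => //.
  exact: seq_cvg_cst.
(* Normality of y at g x, tested at g x_k, gives one sign; normality of [ys k] at g x_k, tested at g
   x, gives the other in the limit. This is the orthogonality in the critical cone, as v - grad f x
   is [jac_adj g x y]. *)
have jp0 : dot (jac_adj g x y) p = 0.
  apply/le_anti/andP; split.
    apply: (ler_cvg_to (Jp _ _ (seq_cvg_cst y)) (err0 _ _ (seq_cvg_cst y))).
    apply: nearW => k.
    have := expand y k; rewrite ler_norml => /andP[h _].
    have h2 : (ts k)^-1 * dot y (G k) <= 0.
      by rewrite pmulr_rle0 ?invr_gt0//; apply: Ny.2; exact: (LA k).2.1.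
    lra.
  rewrite -oppr_le0.
  apply: (ler_cvg_to (cvgN (Jp _ _ ysy)) (err0 _ _ ysy)).
  apply: nearW => k.
  have := expand (ys k) k; rewrite ler_norml => /andP[_ h].
  have h2 : 0 <= (ts k)^-1 * dot (ys k) (G k).
    rewrite pmulr_rge0 ?invr_gt0// -oppr_le0 -dotNr opprB.
    by apply: (LA k).2.2.
  rewrite fctE; lra.
split.
- split; last by rewrite {1}vE [X in dot X _]addrC addKr.
  exists ts, ps; split => //; split; last by split => // k; exact: (LA k).2.1.
  move=> e e0; have /cvgr_lt /(_ e e0)[N _ HN] := tcv.
  by exists N => k Nk; exact: HN.
- by split.
(* Difference quotient of u |-> grad f u + jac_adj g u (ys k), the multiplier being frozen; the rest
   of [qs k] comes from the change of multiplier ([qB]). *)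
pose B k := (ts k)^-1 *: (grad f (x + ts k *: ps k) - grad f x) +
  \sum_j ys k 0 j *: ((ts k)^-1 *: (grad (comp_fun g j) (x + ts k *: ps k) -
     grad (comp_fun g j) x)).
pose B0 := 'd (grad f) x p + \sum_j y 0 j *: 'd (grad (comp_fun g j)) x p.
have BB : seq_cvg B B0.
  apply: seq_cvgD.
    by apply: seq_cvg_grad_quotient => //; exact: (fC xr).1.
  apply: seq_cvg_sum => j; apply: seq_cvgZ.
    by move/seq_cvg_coord : ysy; exact.
  by apply: seq_cvg_grad_quotient => //; exact: (gC j xr).1.
have -> : hessq f x p + hessq_yg g y x p = dot B0 p.
  rewrite dotDl dot_suml; congr (_ + _).
  by apply: eq_bigr => j _; rewrite dotZl.
have BE k : ts k *: B k = grad f (x + ts k *: ps k) - grad f x +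
    (jac_adj g (x + ts k *: ps k) (ys k) - jac_adj g x (ys k)).
  have tk := t0 k.
  rewrite /B scalerDr scalerA divff ?gt_eqF// scale1r; congr (_ + _).
  rewrite scaler_sumr /jac_adj -sumrB; apply: eq_bigr => j _.
  by rewrite !scalerA mulrAC divff ?gt_eqF// mul1r scalerBr.
have qB k : qs k = B k + (ts k)^-1 *: jac_adj g x (ys k - y).
  have tk := t0 k.
  apply: (scalerI (a := ts k)); first by rewrite gt_eqF.
  rewrite scalerDr BE scalerA divff ?gt_eqF// scale1r jac_adjB.
  have -> : ts k *: qs k = (v + ts k *: qs k) - v by rewrite [RHS]addrC addKr.
  rewrite (LA k).1 vE.
  move: (grad f _) (grad f x) (jac_adj g _ (ys k)) (jac_adj g x _) (jac_adj g x y).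
  by move=> a b c d e; apply/rowP => i; rewrite !mxE; ring.
have yy : seq_cvg (fun k => ys k - y) 0.
  by rewrite -(subrr y); apply: seq_cvgB => //; exact: seq_cvg_cst.
have err : (fun k => dot (B k) (ps k) - L * (m%:R * enorm (ys k - y)) * enorm (ps k) ^+ 2)
    @ \oo --> dot B0 p - L * (m%:R * 0) * enorm p ^+ 2.
  apply: cvgB; first exact: cvg_dot.
  apply: cvgM; last first.
    under eq_fun do rewrite expr2; rewrite expr2.
    by apply: cvgM; exact: seq_cvg_enorm.
  apply: cvgM; first exact: cvg_cst.
  apply: cvgM; first exact: cvg_cst.
  by rewrite -(@enorm0 R m); exact: seq_cvg_enorm.
rewrite !mulr0 mul0r subr0 in err.
apply: (ler_cvg_to err (cvg_dot qsq psp)).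
apply: nearW => k; rewrite [X in _ <= dot X _]qB (dotDl (B k)) lerD2l dotZl.
have tk := t0 k.
have := expand (ys k - y) k; rewrite ler_norml => /andP[_ h].
have h2 : 0 <= (ts k)^-1 * dot (ys k - y) (G k).
  rewrite pmulr_rge0 ?invr_gt0// dotBl subr_ge0.
  apply: (@le_trans _ _ 0); first by apply: Ny.2; exact: (LA k).2.1.
  by rewrite -oppr_le0 -dotNr opprB; apply: (LA k).2.2.
rewrite ler_pdivlMl//; lra.
Qed.

End TangentLimit.

(** * Proximal map, Moreau envelope and quadratic growth *)

Section Growth.
Variables (R : realType) (n m : nat).
Variables (f : 'rV[R]_n -> R) (g : 'rV[R]_n -> 'rV[R]_m) (Theta : set 'rV[R]_m).
Variables (xbar : 'rV[R]_n) (r L C rho sigma eta : R).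
Let phi := phi_fun f g Theta.
Hypothesis Tcl : seq_closed Theta.
Hypothesis r0 : 0 < r.
Hypothesis L0 : 0 <= L.
Hypothesis fC : C2_ball f xbar r L.
Hypothesis gC : forall j, C2_ball (comp_fun g j) xbar r L.
Hypothesis rho0 : 0 < rho.
Hypothesis mult : forall x v, edist x xbar < r / 2 -> enorm v <= 1 ->
  reg_subdiff phi x v -> exists2 y, Lambda f g Theta x v y & enorm y <= C.
Hypothesis hypo : forall x x' v, edist x xbar < r / 2 -> edist x' xbar < r / 2 ->
  Theta (g x') -> enorm v <= 1 -> reg_subdiff phi x v ->
  f x + dot v (x' - x) - rho / 2 * edist x' x ^+ 2 <= f x'.
Hypothesis sub0 : reg_subdiff phi xbar 0.
Hypothesis sigma0 : 0 <= sigma.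
Hypothesis eta0 : 0 < eta.
Hypothesis eta1 : eta <= 1.
Hypothesis second_order : forall x v w y, edist x xbar < r -> enorm v < eta ->
  critical_cone (feas g Theta) x (v - grad f x) (- w) -> Lambda f g Theta x v y ->
  sigma * enorm w ^+ 2 <= hessq f x w + hessq_yg g y x w.

Lemma feas_bar : Theta (g xbar).
Proof. by have [] := (@reg_subdiff_phiP R n m f g Theta xbar 0).1 sub0. Qed.

(* Facts such as [have r00 := r0] below put section hypotheses in reach of [lra]. *)
Lemma hypomonotone_pair x1 x2 v1 v2 : edist x1 xbar < r / 2 -> edist x2 xbar < r / 2 ->
  enorm v1 <= 1 -> enorm v2 <= 1 -> reg_subdiff phi x1 v1 -> reg_subdiff phi x2 v2 ->
  - rho * edist x2 x1 ^+ 2 <= dot (v2 - v1) (x2 - x1).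
Proof.
move=> x1r x2r v11 v21 s1 s2.
have T1 := ((@reg_subdiff_phiP R n m f g Theta x1 v1).1 s1).1.
have T2 := ((@reg_subdiff_phiP R n m f g Theta x2 v2).1 s2).1.
have h1 := hypo x1r x2r T2 v11 s1; have h2 := hypo x2r x1r T1 v21 s2.
rewrite (edistC x1) -(opprB x2 x1) dotNr in h2.
rewrite dotBl; lra.
Qed.

(* Proximal points with parameter 1 / (2 rho): the subgradient at the proximal point x
   of z is then 2 rho (z - x). *)
Definition prox (z x : 'rV[R]_n) : Prop :=
  [/\ edist x xbar <= 4 * edist z xbar, reg_subdiff phi x ((2 * rho) *: (z - x)) &
   forall u, edist u xbar <= r / 4 -> Theta (g u) ->
     f x + rho * edist x z ^+ 2 <= f u + rho * edist u z ^+ 2].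

(** A minimizer over the ball of radius r / 4 yields a subgradient only if it is interior, which the
    bound 4 |z - xbar| < r / 4 ensures. *)
Lemma prox_exists z : edist z xbar < r / 16 -> exists x, prox z x.
Proof.
move=> zr; have r00 := r0; have rho00 := rho0.
have [| | |x [xr Tx] xmin] := @exists_minimizer R n
  [set u | edist u xbar <= r / 4 /\ Theta (g u)] (fun u => f u + rho * edist u z ^+ 2)
  (r / 4 + enorm xbar).
- by exists xbar; split; [rewrite edistxx; lra|exact: feas_bar].
- move=> u [ur _]; rewrite -(subrK xbar u) (le_trans (enormD _ _))//.
  by rewrite lerD2r.
- move=> u x uS ux.
  have xr : edist x xbar <= r / 4.
    apply: (ler_cvg_to (seq_cvg_enorm (seq_cvgB ux (seq_cvg_cst xbar))) (cvg_cst (r / 4))).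
    by apply: nearW => k; exact: (uS k).1.
  have ur k : edist (u k) xbar < r by have := (uS k).1; lra.
  have xr' : edist x xbar < r by lra.
  split.
    split => //; apply: (Tcl _ (map_cvg r0 L0 gC ur xr' ux)) => k.
    exact: (uS k).2.
  apply: cvgD; first exact: (C2_ball_cvg r0 L0 fC).
  apply: cvgM; first exact: cvg_cst.
  under eq_fun do rewrite expr2; rewrite expr2.
  by apply: cvgM; apply: seq_cvg_enorm; apply: seq_cvgB => //; exact: seq_cvg_cst.
(* Minimality against [xbar] and hypomonotonicity with the subgradient 0 at [xbar] leave |x -
   xbar|^2 <= 4 |x - xbar| |z - xbar|. *)
have xz4 : edist x xbar <= 4 * edist z xbar.
  have h1 := xmin xbar (conj _ feas_bar); rewrite /= edistxx in h1.
  have {}h1 : f x + rho * edist x z ^+ 2 <= f xbar + rho * edist xbar z ^+ 2.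
    by apply: h1; lra.
  have h2 : f xbar - rho / 2 * edist x xbar ^+ 2 <= f x.
    have := @hypo xbar x 0; rewrite edistxx dot0l addr0 enorm0; apply => //; lra.
  have E : edist x z ^+ 2 = edist x xbar ^+ 2 + 2 * dot (x - xbar) (xbar - z) +
      edist xbar z ^+ 2.
    by rewrite /edist -sqr_enormD subrKA.
  have h3 := cauchy_schwarzN (x - xbar) (xbar - z).
  rewrite E in h1.
  have h4 : rho * edist x xbar ^+ 2 <= rho * (4 * edist x xbar * edist z xbar).
    rewrite (edistC z xbar) /edist.
    have h5 : rho * - (enorm (x - xbar) * enorm (xbar - z)) <=
      rho * dot (x - xbar) (xbar - z) by rewrite ler_wpM2l// ltW.
    rewrite /edist in h1 h2; lra.
  rewrite ler_pM2l// in h4.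
  have [->|xn] := eqVneq (edist x xbar) 0; first by rewrite mulr_ge0 ?edist_ge0.
  have xp : 0 < edist x xbar by rewrite lt_def xn edist_ge0.
  rewrite -(ler_pM2l xp) -expr2; lra.
exists x; split => //; last by move=> u ur Tu; exact: xmin.
apply: (@reg_subdiff_of_quadratic _ _ _ _ _ _ _ _ rho (r / 4 - edist x xbar)) => //.
  by rewrite subr_gt0; lra.
move=> u ux Tu.
have ur : edist u xbar <= r / 4.
  by rewrite (le_trans (edist_triangle x _ _))//; lra.
have := xmin u (conj ur Tu); rewrite /=.
have -> : edist u z ^+ 2 = edist u x ^+ 2 + 2 * dot (u - x) (x - z) + edist x z ^+ 2.
  by rewrite /edist -sqr_enormD subrKA.
rewrite dotZl -(opprB x z) dotNl (dotC (u - x)).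
lra.
Qed.

(** Hypomonotonicity with deficit rho, against the weight 2 rho, gives |x2 - x1|^2 <= 2 <z2 - z1, x2
    - x1>. The case z1 = z2 is uniqueness of proximal points. *)
Lemma prox_lipschitz z1 z2 x1 x2 : edist x1 xbar < r / 2 -> edist x2 xbar < r / 2 ->
  enorm ((2 * rho) *: (z1 - x1)) <= 1 -> enorm ((2 * rho) *: (z2 - x2)) <= 1 ->
  reg_subdiff phi x1 ((2 * rho) *: (z1 - x1)) ->
  reg_subdiff phi x2 ((2 * rho) *: (z2 - x2)) ->
  edist x2 x1 <= 2 * edist z2 z1.
Proof.
move=> x1r x2r v1 v2 s1 s2; have rho00 := rho0.
have := hypomonotone_pair x1r x2r v1 v2 s1 s2.
rewrite -scalerBr dotZl.
have -> : z2 - x2 - (z1 - x1) = (z2 - z1) - (x2 - x1).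
  by apply/rowP => i; rewrite !mxE; ring.
rewrite dotBl -sqr_enorm /edist => h.
have h1 := cauchy_schwarz (z2 - z1) (x2 - x1).
have h2 : rho * enorm (x2 - x1) ^+ 2 <= rho * (2 * enorm (z2 - z1) * enorm (x2 - x1)).
  have : rho * dot (z2 - z1) (x2 - x1) <=
    rho * (enorm (z2 - z1) * enorm (x2 - x1)) by rewrite ler_wpM2l// ltW.
  lra.
rewrite ler_pM2l// in h2.
have [->|xn] := eqVneq (enorm (x2 - x1)) 0; first by rewrite mulr_ge0 ?enorm_ge0.
have xp : 0 < enorm (x2 - x1) by rewrite lt_def xn enorm_ge0.
by rewrite -(ler_pM2r xp) -expr2.
Qed.

Lemma prox_map_exists : exists (d : R) (P : 'rV[R]_n -> 'rV[R]_n),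
  0 < d /\ forall z, edist z xbar < d ->
    [/\ prox z (P z), edist (P z) xbar < r / 4,
      enorm ((2 * rho) *: (z - P z)) < eta & Theta (g (P z))].
Proof.
have r00 := r0; have rho00 := rho0; have eta00 := eta0.
(* From |P z - xbar| <= 4 |z - xbar| follows |z - P z| <= 5 |z - xbar|, whence the constant 10 rho
   for the subgradient 2 rho (z - P z). *)
pose d := Num.min (r / 16) (eta / (10 * rho)).
have dr : d <= r / 16 by rewrite ge_min lexx.
have de : d <= eta / (10 * rho) by rewrite ge_min lexx orbT.
have d0 : 0 < d by rewrite lt_min !divr_gt0// mulr_gt0.
have /choice[P HP] : forall z, exists x, edist z xbar < d -> prox z x.
  move=> z; have [zd|zd] := ltP (edist z xbar) d; last by exists z.
  have [|x Px] := @prox_exists z; first by lra.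
  by exists x.
exists d, P; split => // z zd; have [h1 h2 h3] := HP z zd; split => //.
- lra.
- rewrite enormZ gtr0_norm ?mulr_gt0//.
  have h4 : enorm (z - P z) <= 5 * edist z xbar.
    have := edist_triangle xbar z (P z); rewrite (edistC xbar) /edist.
    by rewrite /edist in h1; lra.
  have h5 : 2 * rho * enorm (z - P z) <= (10 * rho) * edist z xbar.
    have : rho * enorm (z - P z) <= rho * (5 * edist z xbar) by rewrite ler_pM2l.
    lra.
  apply: le_lt_trans h5 _.
  rewrite mulrC -ltr_pdivlMr ?mulr_gt0//; lra.
- by have [] := (@reg_subdiff_phiP R n m f g Theta _ _).1 h2.
Qed.

(** * Monotonicity of the proximal map and strong convexity of the envelope *)

Section ProxMap.
Variables (d : R) (P : 'rV[R]_n -> 'rV[R]_n).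
Hypothesis d0 : 0 < d.
Hypothesis HP : forall z, edist z xbar < d ->
    [/\ prox z (P z), edist (P z) xbar < r / 4,
      enorm ((2 * rho) *: (z - P z)) < eta & Theta (g (P z))].

(** If a map T is strongly monotone with modulus sigma, then I + T / (2 rho) is so with modulus [c];
    P inverts this sum for the localized subdifferential. *)
Let c := 1 + sigma / (2 * rho).
Let V z := (2 * rho) *: (z - P z).

Let c1 : 1 <= c.
Proof. by rewrite lerDl divr_ge0// mulr_ge0// ltW. Qed.
Let c0 : 0 < c.
Proof. exact: lt_le_trans c1. Qed.

Lemma prox_map_lipschitz z1 z2 : edist z1 xbar < d -> edist z2 xbar < d ->
  edist (P z2) (P z1) <= 2 * edist z2 z1.
Proof.
move=> z1d z2d; have r00 := r0; have e1 := eta1.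
have [[_ s1 _] x1r v1 _] := HP z1d; have [[_ s2 _] x2r v2 _] := HP z2d.
apply: prox_lipschitz => //; lra.
Qed.

(* Every limit p of difference quotients of P in the direction w satisfies
   sigma |p|^2 <= 2 rho <w - p, p>, that is c |p|^2 <= <w, p>, whence
   <w, p> <= |w|^2 / c. *)
Lemma prox_tangent z w : edist z xbar < d -> (forall s, 0 <= s <= 1 ->
    edist (z + s *: w) xbar < d) -> forall t e, 0 <= t < 1 -> 0 < e ->
  exists2 dl, 0 < dl & forall s, t < s <= 1 -> s < t + dl ->
    dot w (P (z + s *: w) - P (z + t *: w)) <=
      (enorm w ^+ 2 / c + e) * (s - t).
Proof.
move=> zd seg t e /andP[t0 t1] e0; apply: contrapT => Hn.
have r00 := r0; have rho00 := rho0; have ee1 := eta1.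
(* Failure for every [dl] yields parameters tending to t from the right; a limit of the difference
   quotients along them contradicts the bound. *)
have /choice[ss Hss] : forall k : nat, exists s, [/\ t < s <= 1, s < t + k.+1%:R^-1 &
    (enorm w ^+ 2 / c + e) * (s - t) < dot w (P (z + s *: w) - P (z + t *: w))].
  move=> k; apply: contrapT => /forallNP Hk; apply: Hn.
  exists k.+1%:R^-1 => [|s s1 s2]; first by rewrite invr_gt0.
  by rewrite leNgt; apply/negP => h; apply: (Hk s).
pose ts k := ss k - t.
have ts0 k : 0 < ts k by rewrite subr_gt0; have [/andP[]] := Hss k.
have tcv : ts @ \oo --> (0:R).
  apply/cvgrPdist_lt => ep ep0.
  have /cvgrPdist_lt /(_ ep ep0)[N _ HN] := @cvg_harmonic R.
  exists N => // k Nk; have := HN k Nk; rewrite /= !sub0r !normrN => h.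
  apply: le_lt_trans h; rewrite gtr0_norm// gtr0_norm ?invr_gt0//.
  by rewrite /ts lerBlDl ltW//; have [] := Hss k.
pose zt := z + t *: w; pose zs k := z + ss k *: w.
have t01 : 0 <= t <= 1 by rewrite t0 ltW.
have ztd : edist zt xbar < d by exact: seg.
have zsd k : edist (zs k) xbar < d.
  apply: seg; have [/andP[h1 ->] _ _] := Hss k; rewrite andbT.
  by rewrite (le_trans t0)// ltW.
have zsE k : zs k = zt + ts k *: w.
  by rewrite /zs /zt /ts scalerBl; apply/rowP => i; rewrite !mxE; ring.
pose x := P zt; pose v := V zt.
pose ps k := (ts k)^-1 *: (P (zs k) - x).
have psE k : P (zs k) = x + ts k *: ps k.
  by rewrite /ps scalerA divff ?gt_eqF// scale1r addrC subrK.
pose qs k := (2 * rho) *: (w - ps k).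
have qsE k : V (zs k) = v + ts k *: qs k.
  rewrite /V /v /V -/x psE zsE /qs.
  by apply/rowP => i; rewrite !mxE; ring.
have psb k : enorm (ps k) <= 2 * enorm w.
  rewrite enormZ gtr0_norm ?invr_gt0// ler_pdivrMl//.
  have := prox_map_lipschitz ztd (zsd k); rewrite /edist => /le_trans; apply.
  rewrite zsE [X in enorm X]addrC addKr enormZ gtr0_norm//; lra.
have /choice[ys Hys] : forall k, exists y, Lambda f g Theta (P (zs k)) (V (zs k)) y
    /\ enorm y <= C.
  move=> k; have [[_ s1 _] x1r v1 _] := HP (zsd k).
  have [| |y Ly yC] := mult _ _ s1; [lra|lra|by exists y].
have [s si [p psp]] := bounded_seq_subseq psb.
have [|s' si' [y ysy]] := @bounded_seq_subseq R m (ys \o s) C.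
  by move=> k; exact: (Hys (s k)).2.
have psp' := seq_cvg_subseq si' psp.
pose u := s \o s'.
have ui : increasing_seq u by move=> i j; exact: etrans (si (s' i) (s' j)) (si' i j).
have qsq : seq_cvg (qs \o u) ((2 * rho) *: (w - p)).
  apply: seq_cvgZ; first exact: cvg_cst.
  by apply: seq_cvgB => //; exact: seq_cvg_cst.
have [[_ sx _] xr vx Tx] := HP ztd.
have [||||| cr La H] := @second_order_tangent R n m f g Theta xbar r L Tcl r0 L0 fC gC
  x v p _ y (ts \o u) (ps \o u) (qs \o u) (ys \o u) _ _ _ (cvg_subseq ui tcv) psp' qsq ysy.
- rewrite /x; lra.
- move=> k /=; rewrite -psE; have [_ h _ _] := HP (zsd (u k)); lra.
- by move=> k; exact: ts0.
- by move=> k /=; rewrite -psE -qsE; exact: (Hys (u k)).1.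
- exact: Tx.
(* The condition is stated on the opposite of the critical cone, so it is applied to -p; the
   quadratic forms are even. *)
have so : sigma * enorm (- p) ^+ 2 <= hessq f x (- p) + hessq_yg g y x (- p).
  apply: (second_order (v := v)) => //; first by rewrite /x; lra.
  by rewrite opprK.
have hN (h : 'rV[R]_n -> R) : hessq h x (- p) = hessq h x p.
  by rewrite /hessq linearN dotNl dotNr opprK.
have {}so : sigma * enorm p ^+ 2 <= 2 * rho * (dot w p - enorm p ^+ 2).
  rewrite dotZl dotBl -sqr_enorm in H.
  apply: le_trans H; rewrite -(enormN p); apply: le_trans so _.
  rewrite hN lerD2l /hessq_yg le_eqVlt; apply/orP; left; apply/eqP.
  by apply: eq_bigr => j _; rewrite hN.
have wp : c * enorm p ^+ 2 <= dot w p.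
  rewrite -(@ler_pM2l _ (2 * rho)) ?mulr_gt0//.
  have -> : 2 * rho * (c * enorm p ^+ 2) = (2 * rho + sigma) * enorm p ^+ 2.
    by rewrite /c; field; rewrite gt_eqF.
  lra.
have wpc : dot w p <= enorm w ^+ 2 / c.
  have cs := cauchy_schwarz w p.
  have h1 : c * enorm p <= enorm w.
    have [->|pn] := eqVneq (enorm p) 0; first by rewrite mulr0 enorm_ge0.
    have pp : 0 < enorm p by rewrite lt_def pn enorm_ge0.
    rewrite -(ler_pM2r pp) -mulrA -expr2; lra.
  rewrite (le_trans cs)// ler_pdivlMr// expr2 -mulrA ler_wpM2l ?enorm_ge0//.
  by rewrite mulrC.
have : enorm w ^+ 2 / c + e <= dot w p.
  apply: (ler_cvg_to (cvg_cst (enorm w ^+ 2 / c + e))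
    (cvg_dot (seq_cvg_cst w) psp')).
  apply: nearW => k /=.
  have [_ _ h] := Hss (u k).
  rewrite -/(zs (u k)) -/zt -/x -/(ts (u k)) in h.
  have tk := ts0 (u k).
  by rewrite /ps dotZr ler_pdivlMl// mulrC ltW.
lra.
Qed.

Lemma segment_ball z z' : edist z xbar < d -> edist z' xbar < d ->
  forall s, 0 <= s <= 1 -> edist (z + s *: (z' - z)) xbar < d.
Proof.
move=> zd zd' s s01; have := dist_convex s01 zd' zd; congr (edist _ _ < _).
by apply/rowP => i; rewrite !mxE; ring.
Qed.

(** [prox_tangent] controls the right difference quotients of t |-> <w, P (z + t w)>;
    [dini_nondecreasing] integrates this bound over [0, 1]. *)
Lemma prox_firm z z' : edist z xbar < d -> edist z' xbar < d ->
  dot (z' - z) (P z' - P z) <= edist z' z ^+ 2 / c.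
Proof.
move=> zd zd'; have seg := segment_ball zd zd'; rewrite /edist.
have rwt (s t : R) w : edist (z + s *: w) (z + t *: w) = `|s - t| * enorm w.
  by rewrite /edist -enormZ; congr enorm; rewrite scalerBl opprD addrACA subrr add0r.
move: (z' - z) (subrKC z z') seg => w <- seg.
pose h t := t * (enorm w ^+ 2 / c) - dot w (P (z + t *: w)).
have : h 0 <= h 1; last first.
  by rewrite /h scale0r addr0 scale1r mul0r mul1r dotBr; lra.
apply: dini_nondecreasing => t t01 e e0; last first.
  have [dl dl0 H] := prox_tangent zd seg t01 e0.
  exists dl => // s s1 s2; have := H s s1 s2; rewrite dotBr /h; lra.
pose K := enorm w ^+ 2 / c + 2 * enorm w ^+ 2 + 1.
have w0 : 0 <= enorm w ^+ 2 by rewrite sqr_ge0.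
have wc0 : 0 <= enorm w ^+ 2 / c by rewrite divr_ge0// ltW.
have K0 : 0 < K by rewrite /K; lra.
exists (e / K); first by rewrite divr_gt0.
move=> s s01; rewrite ltr_pdivlMr// => st.
have -> : h s - h t = (s - t) * (enorm w ^+ 2 / c) -
  dot w (P (z + s *: w) - P (z + t *: w)) by rewrite /h dotBr; ring.
rewrite (le_trans (ler_normB _ _))// normrM (ger0_norm wc0).
have h1 := cauchy_schwarz_abs w (P (z + s *: w) - P (z + t *: w)).
have h2 := prox_map_lipschitz (seg t t01) (seg s s01); rewrite rwt in h2.
have h3 : enorm w * enorm (P (z + s *: w) - P (z + t *: w)) <=
  enorm w * (2 * (`|s - t| * enorm w)) by rewrite ler_wpM2l ?enorm_ge0.
have h4 := normr_ge0 (s - t).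
rewrite /K in st; lra.
Qed.

Let e z := f (P z) + rho * edist (P z) z ^+ 2.

(** P z is an admissible competitor in the minimization that defines [e z']. *)
Lemma envelope_le z z' : edist z xbar < d -> edist z' xbar < d ->
  e z' <= e z + dot (V z) (z' - z) + rho * edist z' z ^+ 2.
Proof.
move=> zd zd'; have [_ xr _ Tx] := HP zd; have [[_ _ H] _ _ _] := HP zd'.
have := H (P z) (ltW xr) Tx; rewrite -/(e z') /e => /le_trans; apply.
have -> : edist (P z) z' ^+ 2 = edist (P z) z ^+ 2 + 2 * dot (P z - z) (z - z') +
    edist z z' ^+ 2.
  by rewrite /edist -sqr_enormD subrKA.
rewrite (edistC z) /V dotZl -(opprB z' z) -(opprB z (P z)) dotNl dotNr opprK; lra.
Qed.

(** Equal to 2 rho sigma / (2 rho + sigma), the modulus of the Moreau envelope with parameter 1 / (2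
    rho) of a sigma-strongly convex function. *)
Let mu := 2 * rho * (1 - c^-1).

Lemma residual_strongly_monotone z z' : edist z xbar < d -> edist z' xbar < d ->
  mu * edist z' z ^+ 2 <= dot (V z' - V z) (z' - z).
Proof.
move=> zd zd'; have h := prox_firm zd zd'; rewrite /V -scalerBr dotZl.
have -> : z' - P z' - (z - P z) = (z' - z) - (P z' - P z).
  by apply/rowP => i; rewrite !mxE; ring.
rewrite dotBl -sqr_enorm (dotC (P z' - P z)) /mu -/(edist z' z).
by rewrite -mulrA ler_pM2l ?mulr_gt0//; lra.
Qed.

(* e is the Moreau envelope of phi and V its gradient. *)
Lemma envelope_strongly_convex z z' : edist z xbar < d -> edist z' xbar < d ->
  e z + dot (V z) (z' - z) + mu / 2 * edist z' z ^+ 2 <= e z'.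
Proof.
move=> zd zd'; have seg := segment_ball zd zd'.
have rho00 := rho0; have ee1 := eta1.
rewrite /edist; move: (z' - z) (subrKC z z') seg => w <- seg {zd'}.
have w0 : 0 <= enorm w ^+ 2 by rewrite sqr_ge0.
have stp (s t : R) : z + s *: w - (z + t *: w) = (s - t) *: w.
  by rewrite scalerBl opprD addrACA subrr add0r.
pose h t := e (z + t *: w) - t * dot (V z) w - mu / 2 * t ^+ 2 * enorm w ^+ 2.
have : h 0 <= h 1; last first.
  by rewrite /h scale0r addr0 scale1r mul0r mul1r expr0n expr1n /=; lra.
have up s t : 0 <= s <= 1 -> 0 <= t <= 1 -> e (z + s *: w) <=
    e (z + t *: w) + (s - t) * dot (V (z + t *: w)) w + rho * ((s - t) ^+ 2 * enorm w ^+ 2).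
  move=> s01 t01; have := envelope_le (seg t t01) (seg s s01).
  by rewrite /edist stp dotZr enormZ exprMn real_normK ?num_real.
apply: dini_nondecreasing => t t01 ep ep0; last first.
  pose K := rho * enorm w ^+ 2.
  have K0 : 0 <= K by rewrite mulr_ge0// ltW.
  have K1 : 0 < K + 1 by lra.
  exists (ep / (K + 1)); first by rewrite divr_gt0.
  move=> s /andP[ts s1] std.
  case/andP: t01 => t0 t1.
  have t01 : 0 <= t <= 1 by rewrite t0 ltW.
  have s01 : 0 <= s <= 1 by rewrite s1 andbT; lra.
  have sp : 0 < s by lra.
  (* [up] is used from s back to t: it bounds the increment of e from below by the slope at s, which
     strong monotonicity compares with the slope at z. *)
  have h1 := up t s t01 s01.
  have h2 := residual_strongly_monotone zd (seg s s01).
  have h3 : mu * s * enorm w ^+ 2 <= dot (V (z + s *: w)) w - dot (V z) w.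
    move: h2; rewrite /edist [X in enorm X]addrC addKr [X in dot _ X]addrC addKr.
    rewrite enormZ gtr0_norm// dotZr dotBl => h2.
    rewrite -(ler_pM2l sp); apply: le_trans h2.
    by rewrite le_eqVlt; apply/orP; left; apply/eqP; ring.
  have h4 : (s - t) * (mu * s * enorm w ^+ 2 + dot (V z) w) <=
     (s - t) * dot (V (z + s *: w)) w by rewrite ler_pM2l ?subr_gt0//; lra.
  have mu0 : 0 <= mu.
    rewrite /mu mulr_ge0//; first by rewrite mulr_ge0// ltW.
    by rewrite subr_ge0 invf_le1.
  have h5 : 0 <= mu / 2 * ((s - t) ^+ 2 * enorm w ^+ 2).
    by rewrite mulr_ge0 ?divr_ge0// mulr_ge0// sqr_ge0.
  have h6 : (s - t) * (s - t) * K <= ep * (s - t).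
    have hst : 0 < s - t by rewrite subr_gt0.
    have : (s - t) * (K + 1) <= ep.
      by rewrite -ler_pdivlMr//; lra.
    move=> h6; have : (s - t) * ((s - t) * (K + 1)) <= (s - t) * ep by rewrite ler_pM2l.
    have : 0 <= (s - t) * (s - t) by rewrite mulr_ge0// ltW.
    lra.
  rewrite /K in h6; rewrite /h; lra.
have bnd s : 0 <= s <= 1 -> `|dot (V (z + s *: w)) w| <= enorm w.
  move=> s01; rewrite (le_trans (cauchy_schwarz_abs _ _))//.
  rewrite ler_piMl ?enorm_ge0//; have [_ _ h3 _] := HP (seg s s01).
  by rewrite /V; lra.
pose K := enorm w + rho * enorm w ^+ 2 + `|dot (V z) w| + `|mu / 2| * 2 * enorm w ^+ 2 + 1.
have K0 : 0 < K.
  have A1 := enorm_ge0 w; have A2 : 0 <= rho * enorm w ^+ 2 by rewrite mulr_ge0// ltW.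
  have A3 := normr_ge0 (dot (V z) w).
  have A4 : 0 <= `|mu / 2| * 2 * enorm w ^+ 2 by rewrite mulr_ge0// mulr_ge0.
  rewrite /K; lra.
exists (ep / K); first by rewrite divr_gt0.
move=> s s01; rewrite ltr_pdivlMr// => st.
have st0 := normr_ge0 (s - t).
have st1 : `|s - t| <= 1.
  by rewrite ler_norml; case/andP: s01; case/andP: t01; lra.
have sqst : (s - t) ^+ 2 <= `|s - t|.
  by rewrite -real_normK ?num_real// expr2 ler_piMl.
have eL : `|e (z + s *: w) - e (z + t *: w)| <= `|s - t| * (enorm w + rho * enorm w ^+ 2).
  have aux a b : 0 <= a <= 1 -> 0 <= b <= 1 -> `|a - b| = `|s - t| ->
      (a - b) ^+ 2 = (s - t) ^+ 2 ->
      e (z + a *: w) - e (z + b *: w) <= `|s - t| * (enorm w + rho * enorm w ^+ 2).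
    move=> a01 b01 ab ab2; have := up a b a01 b01; rewrite ab2 => h1.
    have h2 : (a - b) * dot (V (z + b *: w)) w <= `|s - t| * enorm w.
      by rewrite (le_trans (ler_norm _))// normrM ab ler_wpM2l// bnd.
    have h3 : rho * ((s - t) ^+ 2 * enorm w ^+ 2) <= rho * (`|s - t| * enorm w ^+ 2).
      by rewrite ler_pM2l// ler_wpM2r.
    lra.
  rewrite ler_norml; apply/andP; split.
    have := aux t s t01 s01; rewrite distrC => /(_ erefl); rewrite -sqrrN opprB.
    by move=> /(_ erefl); lra.
  exact: aux.
have -> : h s - h t = (e (z + s *: w) - e (z + t *: w)) - (s - t) * dot (V z) w
   - mu / 2 * (s - t) * (s + t) * enorm w ^+ 2 by rewrite /h; ring.
rewrite (le_trans (ler_normB _ _))//.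
rewrite (le_trans (lerD (ler_normB _ _) (lexx _)))//.
rewrite (normrM (s - t) (dot (V z) w)).
have hst : `|s + t| <= 2.
  by rewrite ler_norml; case/andP: s01; case/andP: t01; lra.
have h7 : `|mu / 2 * (s - t) * (s + t) * enorm w ^+ 2| <=
    `|mu / 2| * `|s - t| * 2 * enorm w ^+ 2.
  rewrite [leLHS]normrM (ger0_norm w0) ler_wpM2r//.
  by rewrite normrM (normrM (mu / 2)) ler_wpM2l ?mulr_ge0.
rewrite /K in st; lra.
Qed.

(** Thus every regular subgradient pair close to (xbar, 0) is reached by P. *)
Lemma prox_eq x v z : edist x xbar < r / 2 -> enorm v <= 1 -> reg_subdiff phi x v ->
  v = (2 * rho) *: (z - x) -> edist z xbar < d -> P z = x.
Proof.
move=> xr v1 sv vE zd; have [[_ s1 _] Pr Pv _] := HP zd.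
have r00 := r0; have e1 := eta1.
apply/eqP; rewrite -subr_eq0; apply/eqP/enorm0_eq0/le_anti; rewrite enorm_ge0 andbT.
have := @prox_lipschitz z z x (P z); rewrite edistxx mulr0; apply => //; rewrite -?vE//; lra.
Qed.

(* The strong convexity of e is applied at x + v / (2 rho), whose proximal point is x,
   and at x' + (v + sigma (x' - x)) / (2 rho): this choice of the second point maximizes
   the resulting lower bound of f x' and recovers the exact modulus sigma. *)
Lemma quadratic_growth : exists2 d', 0 < d' & forall x v x', edist x xbar < d' -> enorm v < d' ->
  reg_subdiff phi x v -> edist x' xbar < d' -> Theta (g x') ->
  f x + dot v (x' - x) + sigma / 2 * edist x' x ^+ 2 <= f x'.
Proof.
have r00 := r0; have rho00 := rho0; have dd0 := d0; have ss0 := sigma0.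
pose tau := (2 * rho)^-1.
have tau0 : 0 < tau by rewrite invr_gt0 mulr_gt0.
have rt : 2 * rho * tau = 1 by rewrite divff// gt_eqF// mulr_gt0.
(* As |x' - x| <= 2 d', both v and w have norm at most d' (1 + 2 sigma), so z and z' lie within d' M
   <= d of [xbar]. *)
pose M := 1 + tau * (1 + 2 * sigma).
have M0 : 1 <= M by rewrite lerDl mulr_ge0 ?ltW//; lra.
have M0' : 0 < M by lra.
pose d' := Num.min (d / M) (Num.min (r / 4) 1).
have d'1 : d' * M <= d by rewrite -ler_pdivlMr// ge_min lexx.
have d'2 : d' <= r / 4 by rewrite !ge_min lexx orbT.
have d'3 : d' <= 1 by rewrite !ge_min lexx !orbT.
have d'0 : 0 < d' by rewrite !lt_min !divr_gt0//=.
exists d' => // x v x' xd vd sv xd' Tx'.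
pose w := v + sigma *: (x' - x).
pose z := x + tau *: v; pose z' := x' + tau *: w.
have wb : enorm w <= d' * (1 + 2 * sigma).
  rewrite (le_trans (enormD _ _))// enormZ ger0_norm//.
  have h : enorm (x' - x) <= 2 * d'.
    by have := edist_triangle xbar x' x; rewrite (edistC xbar x) {1}/edist; lra.
  have : sigma * enorm (x' - x) <= sigma * (2 * d') by rewrite ler_wpM2l.
  lra.
have tb a b : edist a xbar < d' -> enorm b <= d' * (1 + 2 * sigma) ->
    edist (a + tau *: b) xbar < d.
  move=> ad bd; apply: lt_le_trans d'1.
  rewrite /edist addrAC (le_lt_trans (enormD _ _))// enormZ gtr0_norm//.
  have : tau * enorm b <= tau * (d' * (1 + 2 * sigma)) by rewrite ler_pM2l.
  rewrite /edist in ad; rewrite /M; lra.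
have vb : enorm v <= d' * (1 + 2 * sigma).
  have h : 0 <= d' * sigma by rewrite mulr_ge0// ltW.
  lra.
have zd := tb x v xd vb; have zd' := tb x' w xd' wb.
rewrite -/z in zd; rewrite -/z' in zd'.
have vz : v = (2 * rho) *: (z - x).
  by rewrite /z [X in _ *: X]addrC addKr scalerA rt scale1r.
have Pz : P z = x by apply: (@prox_eq x v) => //; lra.
have Vz : V z = v by rewrite /V Pz -vz.
have ez : e z = f x + tau / 2 * enorm v ^+ 2.
  rewrite /e Pz /edist -(enormN (x - z)) opprB /z [X in enorm X]addrC addKr.
  rewrite enormZ gtr0_norm// exprMn.
  have -> : tau / 2 * enorm v ^+ 2 = (2 * rho * tau) * (tau / 2 * enorm v ^+ 2).
    by rewrite rt mul1r.
  by congr (_ + _); field.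
have ez' : e z' <= f x' + tau / 2 * enorm w ^+ 2.
  have [[_ _ H] _ _ _] := HP zd'.
  have := H x' _ Tx'; rewrite -/(e z') => /(_ _)/wrap[|h]; first by lra.
  apply: (le_trans h); rewrite lerD2l.
  rewrite /edist -(enormN (x' - z')) opprB /z' [X in enorm X]addrC addKr.
  rewrite enormZ gtr0_norm// exprMn.
  have -> : tau / 2 * enorm w ^+ 2 = (2 * rho * tau) * (tau / 2 * enorm w ^+ 2).
    by rewrite rt mul1r.
  by rewrite le_eqVlt; apply/orP; left; apply/eqP; field.
have := envelope_strongly_convex zd zd'; rewrite Vz ez.
have cE : c = 1 + sigma * tau by [].
(* Collinearity reduces the inequality to an identity in <v, x' - x> and |x' - x|^2. *)
have zz : z' - z = c *: (x' - x).
  rewrite cE /z' /z /w; apply/rowP => i; rewrite !mxE; ring.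
rewrite /edist zz enormZ gtr0_norm// dotZr.
have wE : enorm w ^+ 2 = enorm v ^+ 2 + 2 * sigma * dot v (x' - x) +
    sigma ^+ 2 * enorm (x' - x) ^+ 2.
  by rewrite /w sqr_enormD dotZr enormZ exprMn real_normK ?num_real//; ring.
rewrite wE in ez'.
have muE : mu / 2 * (c * enorm (x' - x)) ^+ 2 =
    (sigma / 2 + tau / 2 * sigma ^+ 2) * enorm (x' - x) ^+ 2.
  have -> : mu / 2 * (c * enorm (x' - x)) ^+ 2 =
     (rho * (c * (c - 1))) * enorm (x' - x) ^+ 2.
    by rewrite /mu; field; rewrite gt_eqF.
  congr (_ * _); rewrite cE.
  have -> : rho * ((1 + sigma * tau) * (1 + sigma * tau - 1)) =
    (2 * rho * tau) * (sigma / 2 + tau / 2 * sigma ^+ 2) by field.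
  by rewrite rt mul1r.
rewrite muE cE => h.
lra.
Qed.

End ProxMap.
End Growth.

(** * Variational convexity and tilt stability *)

Section ConvexSubgradients.
Variables (R : realType) (n : nat).
Implicit Types (psi : 'rV[R]_n -> \bar R).

Lemma EFin_le_of_upper_bounds (X : \bar R) (a : R) :
  (forall b : R, (X <= b%:E)%E -> a <= b) -> (a%:E <= X)%E.
Proof.
case: X => [c| |] H; first by rewrite lee_fin H.
  by rewrite leey.
by have := H (a - 1) (leNye _); rewrite lerBrDr gerDl ler10.
Qed.

Lemma strongly_convex_convex psi (U : set 'rV[R]_n) sigma : 0 <= sigma ->
  strongly_convex_fun_on U psi sigma -> convex_fun_on U psi.
Proof.
move=> s0 H x y t a b Ux Uy t01 xa yb; apply: le_trans (H x y t a b Ux Uy t01 xa yb) _.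
case/andP: t01 => t0 t1.
rewrite lee_fin lerBlDr lerDl mulr_ge0 ?sqr_ge0// mulr_ge0 ?subr_ge0//.
by rewrite mulr_ge0// divr_ge0.
Qed.

(** The local inequality is used at t u + (1 - t) x and convexity carries it to u. Division by t
    makes it global with error e |u - x|, and e is arbitrary. *)
Lemma convex_reg_subdiff psi x v u b : convex_fun_on setT psi ->
  reg_subdiff psi x v -> (psi u <= b%:E)%E -> fine (psi x) + dot v (u - x) <= b.
Proof.
move=> cpsi [xfin H] ub.
rewrite -subr_le0; apply: (@le0_of_le_small _ _ (edist u x) 1) => // e /andP[e0 _].
have [d [d0 Hd]] := H e e0.
have c0 : 0 < edist u x + 1 by rewrite ltr_wpDl ?edist_ge0.
pose t := Num.min 1 (d / (edist u x + 1) / 2).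
have tp : 0 < t by rewrite lt_min ltr01 !divr_gt0.
have t1 : t <= 1 by rewrite ge_min lexx.
have td : t * edist u x < d.
  have h1 : t <= d / (edist u x + 1) / 2 by rewrite ge_min lexx orbT.
  have h2 : t * (edist u x + 1) <= d / 2.
    rewrite (le_trans (ler_wpM2r (ltW c0) h1))// mulrAC divfK// gt_eqF//.
  lra.
have t01 : 0 <= t <= 1 by rewrite t1 ltW.
have xb : (psi x <= (fine (psi x))%:E)%E by rewrite fineK.
have h1 := cpsi u x t b (fine (psi x)) I I t01 ub xb.
have yx : t *: u + (1 - t) *: x - x = t *: (u - x).
  by apply/rowP => i; rewrite !mxE; ring.
have ed : edist (t *: u + (1 - t) *: x) x = t * edist u x.
  by rewrite /edist yx enormZ gtr0_norm.
have := Hd (t *: u + (1 - t) *: x); rewrite ed yx dotZr => /(_ td) h2.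
have := le_trans h2 h1; rewrite lee_fin => h3.
by rewrite -(ler_pM2l tp); lra.
Qed.

Lemma convex_lim_subdiff psi x v u b : convex_fun_on setT psi ->
  lim_subdiff psi x v -> (psi u <= b%:E)%E -> fine (psi x) + dot v (u - x) <= b.
Proof.
move=> cpsi [xfin [xs [vs [xsx [vsv [reg fcv]]]]]] ub.
have fc : (fun k => fine (psi (xs k))) @ \oo --> fine (psi x).
  apply/cvgrPdist_lt => e /fcv[N HN]; exists N => // k /HN.
  by rewrite distrC.
apply: (ler_cvg_to (cvgD fc (cvg_dot vsv (seq_cvgB (seq_cvg_cst u) xsx))) (cvg_cst b)).
by apply: nearW => k; exact: (convex_reg_subdiff cpsi (reg k)).
Qed.

Lemma reg_subdiff_lim psi x v : reg_subdiff psi x v -> lim_subdiff psi x v.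
Proof.
move=> H; split; first exact: H.1.
exists (fun=> x), (fun=> v); split; first exact: seq_cvg_cst.
split; first exact: seq_cvg_cst.
split => // e e0; exists 0%N => k _; by rewrite subrr normr0.
Qed.

End ConvexSubgradients.

(** * Variational convexity, minimality and tilt stability from quadratic growth *)

Section Conclusions.
Variables (R : realType) (n m : nat).
Variables (f : 'rV[R]_n -> R) (g : 'rV[R]_n -> 'rV[R]_m) (Theta : set 'rV[R]_m).
Variables (xbar : 'rV[R]_n) (d sigma : R).
Let phi := phi_fun f g Theta.
Hypothesis d0 : 0 < d.
Hypothesis sigma0 : 0 <= sigma.
Hypothesis sub0 : reg_subdiff phi xbar 0.
Hypothesis growth : forall x v x', edist x xbar < d -> enorm v < d ->
  reg_subdiff phi x v -> edist x' xbar < d -> Theta (g x') ->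
  f x + dot v (x' - x) + sigma / 2 * edist x' x ^+ 2 <= f x'.

Definition minorant (x v u : 'rV[R]_n) : R :=
  f x + dot v (u - x) + sigma / 2 * edist u x ^+ 2.

Definition subgradient_near (x v : 'rV[R]_n) : Prop :=
  [/\ edist x xbar < d, enorm v < d & reg_subdiff phi x v].

(** Taken over the whole space rather than a neighborhood, it is convex on [setT], so that its
    subgradient inequality holds globally. *)
Definition convex_minorant (u : 'rV[R]_n) : \bar R :=
  ereal_sup [set a | exists x v, subgradient_near x v /\ a = (minorant x v u)%:E].

Let psi := convex_minorant.

Lemma minorant_le x v u : subgradient_near x v -> ((minorant x v u)%:E <= psi u)%E.
Proof. by move=> xv; apply: ereal_sup_ubound; exists x, v. Qed.

Lemma convex_minorant_le u b : (forall x v, subgradient_near x v -> minorant x v u <= b) ->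
  (psi u <= b%:E)%E.
Proof. by move=> H; apply: ge_ereal_sup => _ [x [v [xv ->]]]; rewrite lee_fin H. Qed.

(** For a quadratic of curvature sigma, strong convexity is an identity; it passes to the supremum
    as an inequality. *)
Lemma minorant_convex x v y z t : minorant x v (t *: y + (1 - t) *: z) =
  t * minorant x v y + (1 - t) * minorant x v z - sigma / 2 * t * (1 - t) * edist y z ^+ 2.
Proof.
rewrite /minorant /edist.
have -> : t *: y + (1 - t) *: z - x = t *: (y - x) + (1 - t) *: (z - x).
  by apply/rowP => i; rewrite !mxE; ring.
have -> : y - z = (y - x) - (z - x) by rewrite opprB addrA subrK.
move: (y - x) (z - x) => a b.
rewrite sqr_enormB sqr_enormD !enormZ !exprMn !real_normK ?num_real//.
by rewrite dotDr !dotZr dotZl; field.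
Qed.

Lemma convex_minorant_strongly_convex : strongly_convex_fun_on setT psi sigma.
Proof.
move=> y z t a b _ _ /andP[t0 t1] ya zb; apply: convex_minorant_le => x v xv.
have h1 : minorant x v y <= a by rewrite -lee_fin (le_trans (minorant_le _ xv)).
have h2 : minorant x v z <= b by rewrite -lee_fin (le_trans (minorant_le _ xv)).
rewrite minorant_convex lerB// lerD// ler_wpM2l// subr_ge0//.
Qed.

Lemma convex_minorant_lsc U : lsc_on U psi.
Proof.
move=> y _ a /ereal_sup_gt [_ [x [v [xv ->]]]]; rewrite lte_fin => ay.
(* Gradient of the minorant at y; the remaining quadratic term is nonnegative. *)
pose w := v + sigma *: (y - x).
have c0 : 0 < enorm w + 1 by rewrite ltr_wpDl ?enorm_ge0.
exists ((minorant x v y - a) / (enorm w + 1)); split; first by rewrite divr_gt0 ?subr_gt0.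
move=> u _; rewrite ltr_pdivlMr// => uy.
apply: lt_le_trans (minorant_le u xv); rewrite lte_fin.
have : minorant x v u = minorant x v y + dot w (u - y) + sigma / 2 * edist u y ^+ 2.
  rewrite /minorant /edist.
  have -> : u - x = (y - x) + (u - y) by rewrite [RHS]addrC subrKA.
  rewrite sqr_enormD (dotDr v (y - x)) /w (dotDl v) (dotZl sigma).
  by field.
have := cauchy_schwarzN w (u - y); rewrite -/(edist u y).
have : 0 <= sigma / 2 * edist u y ^+ 2 by rewrite mulr_ge0 ?sqr_ge0// divr_ge0.
have := edist_ge0 u y; lra.
Qed.

Lemma convex_minorant_le_phi x : edist x xbar < d -> (psi x <= phi x)%E.
Proof.
move=> xd; rewrite /phi /phi_fun; case: asboolP => [Tx|_]; last by rewrite leey.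
by apply: convex_minorant_le => y v [yd vd s]; exact: growth.
Qed.

(** The regular pairs approximating a limiting subgradient eventually enter the supremum, and their
    minorants converge because the definition includes convergence of the values of [phi]. *)
Lemma lim_subdiff_minorant x v u b : edist x xbar < d -> enorm v < d ->
  lim_subdiff phi x v -> (psi u <= b%:E)%E -> minorant x v u <= b.
Proof.
move=> xd vd [xfin [xs [vs [xsx [vsv [reg fcv]]]]]] ub.
have Tx := phi_fin xfin.
have Tk k : Theta (g (xs k)) by exact: phi_fin (reg k).1.
have fc : (fun k => f (xs k)) @ \oo --> f x.
  apply/cvgrPdist_lt => e /fcv[N HN]; exists N => // k /HN.
  by rewrite /phi !phi_feas//= distrC.
have cv : (fun k => minorant (xs k) (vs k) u) @ \oo --> minorant x v u.
  apply: cvgD.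
    by apply: cvgD => //; apply: cvg_dot => //; apply: seq_cvgB => //; exact: seq_cvg_cst.
  apply: cvgM; first exact: cvg_cst.
  under eq_fun do rewrite expr2; rewrite expr2.
  have h : seq_cvg (fun k => u - xs k) (u - x).
    by apply: seq_cvgB => //; exact: seq_cvg_cst.
  by apply: cvgM; exact: seq_cvg_enorm.
apply: (ler_cvg_to cv (cvg_cst b)).
near=> k.
rewrite -lee_fin; apply: le_trans ub; apply: minorant_le; split => //.
  near: k; apply: (cvgr_lt _ (seq_cvg_enorm (seq_cvgB xsx (seq_cvg_cst xbar)))).
  exact: xd.
near: k; exact: (cvgr_lt _ (seq_cvg_enorm vsv)).
Unshelve. all: by end_near. Qed.

Lemma lim_subdiff_minorant_le x v u : edist x xbar < d -> enorm v < d ->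
  lim_subdiff phi x v -> ((minorant x v u)%:E <= psi u)%E.
Proof. by move=> xd vd s; apply: EFin_le_of_upper_bounds => b; exact: lim_subdiff_minorant. Qed.

Lemma minorantxx x v : minorant x v x = f x.
Proof. by rewrite /minorant subrr dot0r edistxx expr0n mulr0 !addr0. Qed.

Lemma convex_minorant_eq x v : edist x xbar < d -> enorm v < d ->
  lim_subdiff phi x v -> phi x = psi x.
Proof.
move=> xd vd s; apply/le_anti/andP; split; last exact: convex_minorant_le_phi.
have := lim_subdiff_minorant_le x xd vd s; rewrite minorantxx /phi phi_feas//.
exact: phi_fin s.1.
Qed.

Variables (rho dm : R).
Hypothesis rho0 : 0 < rho.
Hypothesis dm0 : 0 < dm.
Hypothesis minty : forall z, edist z xbar < dm -> exists x,
  [/\ edist x xbar <= 4 * edist z xbar, reg_subdiff phi x ((2 * rho) *: (z - x)) &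
   f x <= f xbar + rho * edist xbar z ^+ 2].

(* If v is a subgradient of psi at x, solve z := x + v / (2 rho) = x' + v' / (2 rho) with
   v' a subgradient of phi at x'; monotonicity of the subdifferential of psi forces
   x' = x and v' = v. *)
Lemma strongly_var_convex_of_growth : strongly_var_convex phi xbar 0 sigma.
Proof.
have d00 := d0; have rho00 := rho0; have dm00 := dm0.
split; first exact: reg_subdiff_lim.
pose tau := (2 * rho)^-1.
have tau0 : 0 < tau by rewrite invr_gt0 mulr_gt0.
have rt : 2 * rho * tau = 1 by rewrite divff// gt_eqF// mulr_gt0.
(* [s] bounds |z - xbar|: d / 4 keeps x' and d / (10 rho) keeps its subgradient within the range of
   the growth inequality. Below, r (1 + tau) = s places z = x + v / (2 rho) within [s]. *)
pose s := Num.min dm (Num.min (d / 4) (d / (10 * rho))).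
have s0 : 0 < s by rewrite !lt_min dm0 !divr_gt0//= mulr_gt0.
have s1 : s <= dm by rewrite ge_min lexx.
have s2 : s <= d / 4 by rewrite !ge_min lexx orbT.
have s3 : s * (10 * rho) <= d.
  by rewrite -ler_pdivlMr ?mulr_gt0// !ge_min lexx !orbT.
pose r := s / (1 + tau).
have r0 : 0 < r by rewrite divr_gt0//; lra.
have rs : r * (1 + tau) = s by rewrite divfK// gt_eqF//; lra.
have rts : 0 < r * tau by rewrite mulr_gt0.
have rd : r < d by lra.
(* Points given by [minty] satisfy f x' <= f xbar + rho dm^2, so this level automatically admits
   them. *)
exists [set u | edist u xbar < r], [set v | edist v 0 < r], (rho * dm ^+ 2 + 1).
split; first exact: is_open_ball.
split; first exact: is_convex_ball.
split; first by rewrite /= edistxx.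
split; first exact: is_open_ball.
split; first exact: is_convex_ball.
split; first by rewrite /= edistxx.
split; first by rewrite ltr_wpDl// mulr_ge0 ?sqr_ge0// ltW.
exists psi; split; first exact: convex_minorant_lsc.
split.
  by move=> x y t a b _ _; exact: (convex_minorant_strongly_convex I I).
have bar0 : phi xbar = (f xbar)%:E.
  by rewrite /phi phi_feas//; exact: phi_fin sub0.1.
split; first by move=> x /= xr; apply: convex_minorant_le_phi; lra.
split; last first.
  move=> x v [/= xr [_ [vr sv]]]; rewrite /edist subr0 in vr.
  by apply: (@convex_minorant_eq x v) => //; lra.
move=> x v; split=> [[/= xr [_ [vr sv]]]|[/= xr [vr sv]]].
  split => //; split => //; apply: reg_subdiff_lim.
  have xd : edist x xbar < d by lra.
  have vd : enorm v < d by rewrite /edist subr0 in vr; lra.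
  have E := convex_minorant_eq xd vd sv.
  split; first by rewrite -E; exact: sv.1.
  move=> e e0; exists 1; split => // u _.
  apply: le_trans (lim_subdiff_minorant_le u xd vd sv).
  rewrite lee_fin -E /phi phi_feas//=; last exact: phi_fin sv.1.
  rewrite /minorant lerD2l.
  apply: (@le_trans _ _ 0).
    by rewrite oppr_le0 mulr_ge0 ?edist_ge0// ltW.
  by rewrite mulr_ge0 ?sqr_ge0// divr_ge0.
have vr' : enorm v < r by rewrite /edist subr0 in vr.
pose z := x + tau *: v.
have zs : edist z xbar < s.
  rewrite /edist addrAC (le_lt_trans (enormD _ _))// enormZ gtr0_norm//.
  have : tau * enorm v <= tau * r by rewrite ler_pM2l// ltW.
  by rewrite /edist in xr; lra.
have [x' [x'z sx' fx']] := minty (lt_le_trans zs s1).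
have x'd : edist x' xbar < d by lra.
have v'd : enorm ((2 * rho) *: (z - x')) < d.
  rewrite enormZ gtr0_norm ?mulr_gt0//.
  have h4 : enorm (z - x') <= 5 * edist z xbar.
    have := edist_triangle xbar z x'; rewrite (edistC xbar) /edist.
    by rewrite /edist in x'z; lra.
  have : rho * enorm (z - x') <= rho * (5 * edist z xbar) by rewrite ler_pM2l.
  have : rho * edist z xbar < rho * s by rewrite ltr_pM2l.
  lra.
have Tx' : Theta (g x') by exact: phi_fin sx'.1.
have cpsi : convex_fun_on setT psi.
  exact: strongly_convex_convex sigma0 convex_minorant_strongly_convex.
have h1 : (psi x' <= (f x')%:E)%E.
  by have := convex_minorant_le_phi x'd; rewrite /phi phi_feas.
(* With v' = 2 rho (z - x'), adding [h2] and [h3] gives <v - v', x' - x> <= 0, and v - v' = 2 rho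
   (x' - x). *)
have h2 := convex_lim_subdiff cpsi sv h1.
have h3 : minorant x' ((2 * rho) *: (z - x')) x <= fine (psi x).
  by rewrite -lee_fin fineK ?sv.1//; apply: minorant_le.
have vE : v = (2 * rho) *: (z - x).
  by rewrite /z [X in _ *: X]addrC addKr scalerA rt scale1r.
have xx' : x' = x.
  apply/eqP; rewrite -subr_eq0; apply/eqP/enorm0_eq0.
  have h4 : 2 * rho * enorm (x' - x) ^+ 2 <= 0.
    rewrite {1}vE /minorant !dotZl in h2 h3.
    have h5 : 0 <= sigma / 2 * edist x x' ^+ 2 by rewrite mulr_ge0 ?sqr_ge0// divr_ge0.
    have h6 : z - x' = (z - x) - (x' - x) by rewrite opprB addrA subrK.
    rewrite h6 -(opprB x' x) dotNr dotBl -sqr_enorm in h3.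
    lra.
  rewrite pmulr_rle0 ?mulr_gt0// in h4.
  by apply/eqP; rewrite -sqrf_eq0; apply/eqP/le_anti; rewrite h4 sqr_ge0.
rewrite xx' in sx' fx' Tx'; rewrite -vE in sx'.
split => //; split; last by split => //; exact: reg_subdiff_lim.
rewrite /phi phi_feas// -/phi bar0 -EFinD lte_fin.
apply: le_lt_trans fx' _; rewrite ltrD2l edistC.
rewrite (@le_lt_trans _ _ (rho * dm ^+ 2))//; last by rewrite ltrDl.
rewrite ler_pM2l// lerXn2r ?nnegrE ?edist_ge0 ?(ltW dm0)//; lra.
Qed.

Lemma growth_bar u : edist u xbar < d -> Theta (g u) ->
  f xbar + sigma / 2 * edist u xbar ^+ 2 <= f u.
Proof.
move=> ud Tu; have := @growth xbar 0 u; rewrite edistxx enorm0 dot0l addr0.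
by apply.
Qed.

Lemma local_min_of_growth : local_min f (feas g Theta) xbar.
Proof.
split; first exact: phi_fin sub0.1.
exists [set u | edist u xbar < d]; split; first by exists d.
move=> u ud Tu; apply: le_trans (growth_bar ud Tu).
by rewrite lerDl mulr_ge0 ?sqr_ge0// divr_ge0.
Qed.

Hypothesis sigma_gt0 : 0 < sigma.

Lemma strong_local_min_of_growth : strong_local_min f (feas g Theta) xbar.
Proof.
split; first exact: phi_fin sub0.1.
exists (sigma / 2); split; first by rewrite divr_gt0.
by exists [set u | edist u xbar < d]; split; [exists d|exact: growth_bar].
Qed.

(** For a small tilt v the minimizer is interior, so v is a regular subgradient there. Growth then
    gives uniqueness, and its sum at two minimizers gives sigma |x1 - x2|^2 <= <v1 - v2, x1 -
    x2>. *)
Lemma tilt_stable_of_growth (r L : R) : 0 < r -> 0 <= L -> seq_closed Theta ->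
  C2_ball f xbar r L -> (forall j, C2_ball (comp_fun g j) xbar r L) ->
  tilt_stable phi xbar sigma^-1.
Proof.
move=> r0 L0 Tcl fC gC.
have d00 := d0; have s00 := sigma_gt0.
have Tbar : Theta (g xbar) := phi_fin sub0.1.
pose gam := Num.min (d / 2) (r / 2).
have gam0 : 0 < gam by rewrite lt_min !divr_gt0.
have gd : gam <= d / 2 by rewrite ge_min lexx.
have gr : gam <= r / 2 by rewrite ge_min lexx orbT.
(* Growth at [xbar] gives (sigma / 2) |x - xbar| <= |v| for a minimizer x, so |v| < gam sigma / 2
   makes x interior. *)
pose w0 := Num.min d (gam * sigma / 2).
have w00 : 0 < w0 by rewrite lt_min d00 divr_gt0// mulr_gt0.
have w1 : w0 <= d by rewrite ge_min lexx.
have w2 : w0 <= gam * sigma / 2 by rewrite ge_min lexx orbT.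
have exM v : enorm v < w0 -> exists x, [/\ edist x xbar < d, Theta (g x),
    reg_subdiff phi x v & M_tilt phi xbar gam v = [set x]].
  move=> vw.
  have [| | |x [xg Tx] xmin] := @exists_minimizer R n
    [set u | edist u xbar <= gam /\ Theta (g u)] (fun u => f u - dot v u)
    (gam + enorm xbar).
  - by exists xbar; split => //; rewrite edistxx ltW.
  - move=> u [ur _]; rewrite -(subrK xbar u) (le_trans (enormD _ _))//.
    by rewrite lerD2r.
  - move=> u x uS ux.
    have xg : edist x xbar <= gam.
      apply: (ler_cvg_to (seq_cvg_enorm (seq_cvgB ux (seq_cvg_cst xbar))) (cvg_cst gam)).
      by apply: nearW => k; exact: (uS k).1.
    have ur k : edist (u k) xbar < r by have := (uS k).1; lra.
    have xr : edist x xbar < r by lra.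
    split.
      split => //; apply: (Tcl (fun k => g (u k)) (g x) _ (map_cvg r0 L0 gC ur xr ux)) => k.
      exact: (uS k).2.
    apply: cvgB; first exact: (C2_ball_cvg r0 L0 fC).
    exact: (cvg_dot (seq_cvg_cst v) ux).
  have xd : edist x xbar < d by lra.
  have xlt : edist x xbar < gam.
    have h1 := growth_bar xd Tx.
    have h2 := xmin xbar (conj _ Tbar); rewrite /= edistxx in h2.
    have {}h2 := h2 (ltW gam0).
    have h3 := cauchy_schwarz v (x - xbar); rewrite -/(edist x xbar) dotBr in h3.
    have [->//|xn] := eqVneq (edist x xbar) 0.
    have xp : 0 < edist x xbar by rewrite lt_def xn edist_ge0.
    have h4 : sigma / 2 * edist x xbar <= enorm v.
      by rewrite -(ler_pM2r xp); rewrite expr2 in h1; lra.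
    rewrite -(@ltr_pM2l _ (sigma / 2)) ?divr_gt0//.
    by apply: le_lt_trans h4 _; lra.
  have sx : reg_subdiff phi x v.
    apply: (@reg_subdiff_of_quadratic _ _ _ _ _ _ _ _ 0 (gam - edist x xbar)) => //.
      by rewrite subr_gt0.
    move=> u ux Tu; rewrite mul0r subr0 dotBr.
    have := xmin u (conj _ Tu); rewrite /= => /(_ _)/wrap[|h]; last by lra.
    by rewrite (le_trans (edist_triangle x _ _))//; lra.
  exists x; split => //; apply/seteqP; split=> [u [ug umin]|_ ->] /=; last first.
    split => // u ug; rewrite /phi phi_feas// /phi_fun; case: asboolP => [Tu|_].
      by rewrite -!EFinB lee_fin; exact: xmin.
    by rewrite addye ?leey.
  have := umin x xg; rewrite [X in (_ <= X - _)%E]/phi [X in (_ <= X - _)%E]phi_feas//.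
  rewrite /phi /phi_fun; case: asboolP => [Tu|_]; last by rewrite addye// leNgt ltey.
  rewrite -!EFinB lee_fin => h.
  have ud : edist u xbar < d by lra.
  have vd : enorm v < d by lra.
  have := growth xd vd sx ud Tu; rewrite dotBr => h2.
  have h3 : sigma / 2 * edist u x ^+ 2 <= 0 by lra.
  rewrite pmulr_rle0 ?divr_gt0// in h3.
  apply/eqP; rewrite -subr_eq0; apply/eqP/enorm0_eq0.
  by apply/eqP; rewrite -sqrf_eq0; apply/eqP/le_anti; rewrite h3 sqr_ge0.
have /choice[M HM] : forall v, exists x, enorm v < w0 -> [/\ edist x xbar < d, Theta (g x),
    reg_subdiff phi x v & M_tilt phi xbar gam v = [set x]].
  move=> v; have [vw|vw] := ltP (enorm v) w0; last by exists xbar.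
  by have [x Hx] := exM v vw; exists x.
exists gam; split => //; exists [set v | enorm v < w0], M; split.
  by exists w0; split => // v; rewrite /edist subr0.
split; first by move=> v /HM[].
split.
  have [|_ _ _ E] := HM 0; first by rewrite enorm0.
  suff : M_tilt phi xbar gam 0 xbar by rewrite E => /= ->.
  split; first by rewrite edistxx ltW.
  move=> u ug; rewrite !dot0l /phi phi_feas// /phi_fun; case: asboolP => [Tu|_].
    rewrite -!EFinB lee_fin !subr0.
    apply: le_trans (growth_bar _ Tu); last by lra.
    by rewrite lerDl mulr_ge0 ?sqr_ge0// divr_ge0.
  by rewrite addye ?leey.
move=> v1 v2 v1w v2w; rewrite /= in v1w v2w.
have [x1d T1 s1 _] := HM v1 v1w; have [x2d T2 s2 _] := HM v2 v2w.
have v1d : enorm v1 < d by lra.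
have v2d : enorm v2 < d by lra.
have h1 := growth x1d v1d s1 x2d T2.
have h2 := growth x2d v2d s2 x1d T1.
rewrite (edistC (M v2)) in h1.
rewrite -(opprB (M v1) (M v2)) dotNr in h1.
have h3 := cauchy_schwarz (v1 - v2) (M v1 - M v2).
rewrite dotBl -/(edist _ _) -/(edist _ _) in h3.
have [->|xn] := eqVneq (edist (M v1) (M v2)) 0.
  by rewrite mulr_ge0 ?edist_ge0// invr_ge0.
have xp : 0 < edist (M v1) (M v2) by rewrite lt_def xn edist_ge0.
rewrite mulrC ler_pdivlMr// -(ler_pM2r xp); lra.
Qed.

End Conclusions.

(** Fixes common radii and constants, and leaves of the proximal map only the solvability of z = x +
    v / (2 rho). The pair [r], [L] is returned for the existence of tilted minimizers. *)
Lemma growth_and_minty (R : realType) (n m : nat)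
  (f : 'rV[R]_n -> R) (g : 'rV[R]_n -> 'rV[R]_m) (Theta : set 'rV[R]_m)
  (xbar : 'rV[R]_n) (ybar : 'rV[R]_m) (sigma : R) :
  convex_polyhedron Theta ->
  C2_around f xbar ->
  (forall j : 'I_m, C2_around (comp_fun g j) xbar) ->
  MSCQ g Theta xbar ->
  normal_cone Theta (g xbar) ybar ->
  grad f xbar + jac_adj g xbar ybar = 0 ->
  0 <= sigma ->
  (exists U V : set 'rV[R]_n, is_nbhd U xbar /\ is_nbhd V 0 /\
      forall x v w y, U x -> V v ->
        critical_cone (feas g Theta) x (v - grad f x) (- w) ->
        Lambda f g Theta x v y ->
        sigma * enorm w ^+ 2 <= hessq f x w + hessq_yg g y x w) ->
  let phi := phi_fun f g Theta in
  exists d r L rho dm : R,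
  [/\ [/\ 0 < d, 0 < r, 0 <= L, 0 < rho & 0 < dm],
    C2_ball f xbar r L /\ (forall j, C2_ball (comp_fun g j) xbar r L),
    reg_subdiff phi xbar 0,
    forall x v x', edist x xbar < d -> enorm v < d ->
      reg_subdiff phi x v -> edist x' xbar < d -> Theta (g x') ->
      f x + dot v (x' - x) + sigma / 2 * edist x' x ^+ 2 <= f x' &
    forall z, edist z xbar < dm -> exists x,
      [/\ edist x xbar <= 4 * edist z xbar, reg_subdiff phi x ((2 * rho) *: (z - x)) &
        f x <= f xbar + rho * edist xbar z ^+ 2]].
Proof.
move=> poly fC2 gC2 [kappa [kappa0 [Um [[rm [rm0 Hrm]] mscq]]]] Ny gradE sigma0.
move=> [U [V [[rU [rU0 HU]] [[rV [rV0 HV]] so]]]] phi.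
have Tcl := polyhedron_closed poly; have Tcv := polyhedron_convex poly.
have [r1 [L [r10 L0 HC]]] := @C2_around_ball_all R n (option 'I_m)
  (fun o => if o is Some j then comp_fun g j else f) xbar
  (fun o => if o is Some j then gC2 j else fC2).
pose r := Num.min r1 (Num.min rm rU).
have r0 : 0 < r by rewrite !lt_min r10 rm0.
have rr1 : r <= r1 by rewrite ge_min lexx.
have rrm : r <= rm by rewrite !ge_min lexx orbT.
have rrU : r <= rU by rewrite !ge_min lexx !orbT.
have fC : C2_ball f xbar r L := C2_ball_mono rr1 (lexx L) (HC None).
have gC j : C2_ball (comp_fun g j) xbar r L := C2_ball_mono rr1 (lexx L) (HC (Some j)).
have mscq' x : edist x xbar < r -> setdist x (feas g Theta) <= kappa * setdist (g x) Theta.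
  by move=> xr; apply/mscq/Hrm/(lt_le_trans xr).
have [C C0 mult] := bounded_multiplier Tcl Tcv r0 L0 fC gC kappa0 mscq'.
have bar_r : edist xbar xbar < r by rewrite edistxx.
have Lbar : Lambda f g Theta xbar 0 ybar by split.
have Tbar : Theta (g xbar) := Ny.1.
have sub0 : reg_subdiff phi xbar 0.
  (* This constant is for the single multiplier [ybar], whose norm may exceed [C]; the one used
     afterwards is for multipliers bounded by [C]. *)
  have [rho rho0 H] := hypomonotone Theta L0 fC gC (enorm_ge0 ybar).
  apply: (@reg_subdiff_of_quadratic _ _ _ _ _ _ _ _ (rho / 2) r) => // u ur Tu.
  exact: (H xbar u 0 ybar).
have [rho rho0 hyp] := hypomonotone Theta L0 fC gC (ltW C0).
have hypo x x' v : edist x xbar < r / 2 -> edist x' xbar < r / 2 ->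
    Theta (g x') -> enorm v <= 1 -> reg_subdiff phi x v ->
    f x + dot v (x' - x) - rho / 2 * edist x' x ^+ 2 <= f x'.
  move=> xr x'r Tx' v1 sv; have [y Ly yC] := mult x v xr v1 sv.
  by apply: (hyp x x' v y) => //; lra.
pose eta := Num.min 1 rV.
have eta0 : 0 < eta by rewrite lt_min ltr01.
have eta1 : eta <= 1 by rewrite ge_min lexx.
have so' x v w y : edist x xbar < r -> enorm v < eta ->
    critical_cone (feas g Theta) x (v - grad f x) (- w) -> Lambda f g Theta x v y ->
    sigma * enorm w ^+ 2 <= hessq f x w + hessq_yg g y x w.
  move=> xr; rewrite lt_min => /andP[_ vr]; apply: so; first exact/HU/(lt_le_trans xr).
  by apply: HV; rewrite /edist subr0.
have [dm [P [dm0 HP]]] := prox_map_exists Tcl r0 L0 fC gC rho0 hypo sub0 eta0.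
have [d d0 gr] := quadratic_growth Tcl r0 L0 fC gC rho0 mult hypo sigma0 eta1 so' dm0 HP.
exists d, r, L, rho, dm; split => // z zd.
have [[h1 h2 h3] _ _ _] := HP z zd; exists (P z); split => //.
have := h3 xbar; rewrite edistxx => /(_ _ Tbar)/wrap[|h]; first by rewrite divr_ge0// ltW.
apply: le_trans h; rewrite lerDl mulr_ge0 ?sqr_ge0// ltW//.
Qed.

Theorem theorem8p3 (R : realType) (n m : nat)
  (f : 'rV[R]_n -> R) (g : 'rV[R]_n -> 'rV[R]_m) (Theta : set 'rV[R]_m)
  (xbar : 'rV[R]_n) (ybar : 'rV[R]_m) :
  convex_polyhedron Theta ->
  C2_around f xbar ->
  (forall j : 'I_m, C2_around (comp_fun g j) xbar) ->
  Theta (g xbar) ->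
  MSCQ g Theta xbar ->
  normal_cone Theta (g xbar) ybar ->
  grad f xbar + jac_adj g xbar ybar = 0 ->
  (* (i) *)
  ((exists U V : set 'rV[R]_n, is_nbhd U xbar /\ is_nbhd V 0 /\
      forall x v w y, U x -> V v ->
        critical_cone (feas g Theta) x (v - grad f x) (- w) ->
        Lambda f g Theta x v y ->
        0 <= hessq f x w + hessq_yg g y x w) ->
   var_convex (phi_fun f g Theta) xbar 0 /\ local_min f (feas g Theta) xbar) /\
  (* (ii) *)
  (forall sigma : R, 0 < sigma ->
   (exists U V : set 'rV[R]_n, is_nbhd U xbar /\ is_nbhd V 0 /\
      forall x v w y, U x -> V v ->
        critical_cone (feas g Theta) x (v - grad f x) (- w) ->
        Lambda f g Theta x v y ->
        sigma * enorm w ^+ 2 <= hessq f x w + hessq_yg g y x w) ->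
   strongly_var_convex (phi_fun f g Theta) xbar 0 sigma /\
   tilt_stable (phi_fun f g Theta) xbar sigma^-1 /\
   strong_local_min f (feas g Theta) xbar).
Proof.
move=> poly fC gC Tbar mscq Ny gradE; split.
  move=> [U [V [HU [HV so]]]].
  (* Part (i) is the case sigma = 0, where strong convexity with modulus 0 is weakened to
     convexity. *)
  have [|d [r [L [rho [dm [[d0 r0 L0 rho0 dm0] _ sub0 gr mi]]]]]] :=
    @growth_and_minty R n m f g Theta xbar ybar 0 poly fC gC mscq Ny gradE (lexx 0).
    exists U, V; split => //; split => // x v w y Ux Vv cr La.
    by rewrite mul0r; exact: (so x v).
  split; last exact: local_min_of_growth d0 (lexx 0) sub0 gr.
  have [lim [U' [V' [eps [Uo [Uc [Ux [Vo [Vc [Vx [e0 [psi [psil [psic vc]]]]]]]]]]]]]] :=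
    strongly_var_convex_of_growth d0 (lexx 0) sub0 gr rho0 dm0 mi.
  split => //; exists U', V', eps; do 7 split => //.
  by exists psi; split => //; split => //; exact: strongly_convex_convex (lexx 0) psic.
move=> sigma sigma0 so; have s0 : 0 <= sigma := ltW sigma0.
have [d [r [L [rho [dm [[d0 r0 L0 rho0 dm0] [fC' gC'] sub0 gr mi]]]]]] :=
  growth_and_minty poly fC gC mscq Ny gradE s0 so.
have Tcl := polyhedron_closed poly.
have vc := strongly_var_convex_of_growth d0 s0 sub0 gr rho0 dm0 mi.
split; first exact: vc.
split.
  exact: (tilt_stable_of_growth d0 s0 sub0 gr sigma0 r0 L0 Tcl fC' gC').
exact: strong_local_min_of_growth d0 sub0 gr sigma0.
Qed.
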